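(* Let $S$ be an arbitrary regular local ring, $f\in S$ a non-zero non-unit, and $R^\#=S[y]/(f+y^n)$ for some integer $n\ge 2$. Assume that $n$ is a unit in $S$. Then for any MCM $R^\#$-module $N$ we have $$\Omega_{R^\#}(N/y^{n-1}N)\cong N\oplus\Omega_{R^\#}(N).$$
   Context: MCM means maximal Cohen-Macaulay (finitely generated with depth equal to the dimension of the ring, or zero). The ring $R^\#$ is commutative, Noetherian and local; $\Omega_{R^\#}(X)$ denotes the first syzygy of a finitely generated module $X$, i.e. the kernel of a minimal free cover of $X$, unique up to isomorphism. *)

(* Defs.v *)
From HB Require Import structures.
From mathcomp Require Import all_boot all_algebra.
From mathcomp Require Import boolp.

Set Implicit Arguments.
Unset Strict Implicit.
Unset Printing Implicit Defensive.

Import GRing.Theory.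
Local Open Scope ring_scope.

(* Ideals are boolean predicates [{pred R}]; by classical logic ([boolp])
   these are all the subsets of [R].  [idealr_closed] means a proper ideal. *)
Section Rings.
Variable R : comNzRingType.

Definition prime_ideal (P : {pred R}) : Prop :=
  idealr_closed P /\ prime_idealr_closed P.

Definition maximal_ideal (m : {pred R}) : Prop :=
  idealr_closed m /\
  forall J : {pred R}, idealr_closed J -> {subset m <= J} -> J =i m.

Definition unique_maximal_ideal (m : {pred R}) : Prop :=
  maximal_ideal m /\ forall m' : {pred R}, maximal_ideal m' -> m' =i m.

(* A chain P 0 < P 1 < ... < P d; the values of P beyond d are irrelevant. *)
Definition has_prime_chain (d : nat) : Prop :=
  exists P : nat -> {pred R},
    (forall i, (i <= d)%N -> prime_ideal (P i)) /\
    (forall i, (i < d)%N ->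
       {subset P i <= P i.+1} /\ ~ {subset P i.+1 <= P i}).

Definition krull_dim (d : nat) : Prop :=
  has_prime_chain d /\ forall k, has_prime_chain k -> (k <= d)%N.

End Rings.
Arguments krull_dim : clear implicits.

Section Modules.
Variables (R : comNzRingType) (M : lmodType R).

Definition in_span (r : nat) (g : 'I_r -> M) (x : M) : Prop :=
  exists c : 'I_r -> R, x = \sum_i c i *: g i.

Definition fin_gen : Prop :=
  exists (r : nat) (g : 'I_r -> M), forall x, in_span g x.

(* Membership in the submodule (x_1, ..., x_k) M. *)
Definition in_seq_mul (xs : seq R) (u : M) : Prop :=
  exists v : 'I_(size xs) -> M, u = \sum_(i < size xs) xs`_i *: v i.

Definition regular_seq (xs : seq R) : Prop :=
  (forall (i : nat) (u : M), (i < size xs)%N ->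
     in_seq_mul (take i xs) (xs`_i *: u) -> in_seq_mul (take i xs) u) /\
  exists u, ~ in_seq_mul xs u.

Definition depth (m : {pred R}) (k : nat) : Prop :=
  (exists xs : seq R,
     [/\ {subset xs <= m}, regular_seq xs & size xs = k]) /\
  (forall xs : seq R,
     {subset xs <= m} -> regular_seq xs -> (size xs <= k)%N).

Definition MCM : Prop :=
  fin_gen /\
  ((forall x : M, x = 0) \/
   exists (m : {pred R}) (d : nat),
     [/\ unique_maximal_ideal m, krull_dim R d & depth m d]).

End Modules.
Arguments fin_gen {R} M.
Arguments MCM {R} M.

(* [R^o] is R as a module over itself, so [submod_closed] means an ideal,
   possibly improper. *)
Definition noetherian (R : comNzRingType) : Prop :=
  forall I : {pred R^o}, submod_closed I ->
    exists (r : nat) (g : 'I_r -> R^o), forall x, x \in I <-> in_span g x.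

Definition regular_local (R : comNzRingType) : Prop :=
  noetherian R /\
  exists (m : {pred R}) (d : nat),
    [/\ unique_maximal_ideal m, krull_dim R d
      & exists g : 'I_d -> R^o, forall x, x \in m <-> in_span g x].

Section Linear.
Variables (R : comNzRingType) (U V : lmodType R).

Definition surjective_map (e : U -> V) : Prop := forall x, exists u, e u = x.

Definition mod_iso : Prop := exists phi : {linear U -> V}, bijective phi.

Definition ker_pred (e : {linear U -> V}) : {pred U} := fun u => e u == 0.

Lemma ker_pred_closed e : submod_closed (ker_pred e).
Proof.
split; first by rewrite unfold_in /ker_pred linear0.
move=> a u v; rewrite !unfold_in /ker_pred => /eqP eu /eqP ev.
by rewrite linearP eu ev scaler0 addr0.
Qed.

HB.instance Definition _ (e : {linear U -> V}) :=
  GRing.isSubmodClosed.Build R U (ker_pred e)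
    (GRing.submod_closed_semi (ker_pred_closed e)).

Definition ker_mod (e : {linear U -> V}) : Type := {u : U | u \in ker_pred e}.

HB.instance Definition _ (e : {linear U -> V}) := Choice.on (ker_mod e).
HB.instance Definition _ (e : {linear U -> V}) :=
  SubType.copy (ker_mod e) {u : U | u \in ker_pred e}.
HB.instance Definition _ (e : {linear U -> V}) :=
  [SubChoice_isSubLmodule of ker_mod e by <:].

End Linear.
Arguments mod_iso {R} U V.

(* The first syzygy of X is [ker_mod e] for a minimal free cover e of X. *)
Definition minimal_free_cover (R : comNzRingType) (X : lmodType R) (r : nat)
    (e : {linear 'rV[R]_r -> X}) : Prop :=
  surjective_map e /\
  forall (s : nat) (e' : {linear 'rV[R]_s -> X}),
    surjective_map e' -> (r <= s)%N.

Section FreeCover.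
Variables (R : comNzRingType) (X : lmodType R).

Definition free_map (r : nat) (g : 'I_r -> X) (u : 'rV[R]_r) : X :=
  \sum_i u 0 i *: g i.

Fact free_map_is_linear r (g : 'I_r -> X) : linear (free_map g).
Proof.
move=> a u v; rewrite /free_map scaler_sumr -big_split /=.
by apply: eq_bigr => i _; rewrite !mxE scalerDl scalerA.
Qed.

HB.instance Definition _ r (g : 'I_r -> X) :=
  GRing.isLinear.Build R 'rV[R]_r X _ (free_map g) (free_map_is_linear g).

Lemma minimal_free_cover_exists : fin_gen X ->
  exists (r : nat) (e : {linear 'rV[R]_r -> X}), minimal_free_cover e.
Proof.
case=> r0 [g gen].
pose P r := `[< exists e : {linear 'rV[R]_r -> X}, surjective_map e >].
have exP : exists r, P r.
  exists r0; apply/asboolP; exists (free_map g) => x.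
  have [c ->] := gen x; exists (\row_i c i).
  by apply: eq_bigr => i _; rewrite mxE.
have [r /asboolP[e e_surj] r_min] := ex_minnP exP.
exists r, e; split=> // s e' e'_surj.
by apply: r_min; apply/asboolP; exists e'.
Qed.

End FreeCover.

Section QuotientByScalar.
Variables (R : comNzRingType) (N : lmodType R) (a : R).

Definition scaled_pred : {pred N} := fun u => `[< exists v, u = a *: v >].

Lemma scaled_pred_closed : submod_closed scaled_pred.
Proof.
split; first by rewrite unfold_in; apply/asboolP; exists 0; rewrite scaler0.
move=> b u v; rewrite !unfold_in.
move=> /asboolP[u' ->] /asboolP[v' ->]; apply/asboolP; exists (b *: u' + v').
by rewrite scalerDr !scalerA mulrC.
Qed.

HB.instance Definition _ :=
  GRing.isSubmodClosed.Build R N scaled_pred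
    (GRing.submod_closed_semi scaled_pred_closed).

Definition quot_scaled : Type := Quotient.quot scaled_pred.

HB.instance Definition _ := GRing.Zmodule.on quot_scaled.

Definition quot_proj (u : N) : quot_scaled :=
  \pi_(Quotient.quot scaled_pred)%qT u.

Definition quot_repr (x : quot_scaled) : N :=
  repr (x : Quotient.quot scaled_pred).

Lemma quot_reprK : cancel quot_repr quot_proj.
Proof. exact: reprK. Qed.

Lemma quot_projB : {morph quot_proj : u v / u - v}.
Proof. exact: raddfB. Qed.

Lemma quot_projD : {morph quot_proj : u v / u + v}.
Proof. exact: raddfD. Qed.

Lemma quot_proj_eqP (u v : N) :
  quot_proj u = quot_proj v <-> exists w, u - v = a *: w.
Proof.
split=> [/eqP|uv].
  by rewrite /quot_proj -Quotient.idealrBE unfold_in => /asboolP.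
by apply/eqP; rewrite /quot_proj -Quotient.idealrBE unfold_in; apply/asboolP.
Qed.

Definition quot_scale (b : R) (x : quot_scaled) : quot_scaled :=
  quot_proj (b *: quot_repr x).

Lemma quot_projZ (b : R) (u : N) :
  quot_proj (b *: u) = quot_scale b (quot_proj u).
Proof.
have /quot_proj_eqP[w uw] := esym (quot_reprK (quot_proj u)).
by apply/quot_proj_eqP; exists (b *: w); rewrite -scalerBr uw !scalerA mulrC.
Qed.

Fact quot_scaleA b c x : quot_scale b (quot_scale c x) = quot_scale (b * c) x.
Proof. by rewrite -[x]quot_reprK -!quot_projZ scalerA. Qed.

Fact quot_scale1 : left_id 1 quot_scale.
Proof. by move=> x; rewrite -[x]quot_reprK -!quot_projZ scale1r. Qed.

Fact quot_scaleDr : right_distributive quot_scale +%R.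
Proof.
move=> b x y; rewrite -[x]quot_reprK -[y]quot_reprK.
by rewrite -quot_projD -!quot_projZ scalerDr quot_projD.
Qed.

Fact quot_scaleDl x : {morph quot_scale^~ x : b c / b + c}.
Proof.
move=> b c; rewrite -[x]quot_reprK.
by rewrite -!quot_projZ scalerDl quot_projD.
Qed.

HB.instance Definition _ :=
  GRing.Zmodule_isLmodule.Build R quot_scaled
    quot_scaleA quot_scale1 quot_scaleDr quot_scaleDl.

Fact quot_proj_is_linear : linear quot_proj.
Proof. by move=> b u v; rewrite quot_projD quot_projZ. Qed.

HB.instance Definition _ :=
  GRing.isLinear.Build R N quot_scaled _ quot_proj quot_proj_is_linear.

End QuotientByScalar.

Definition cover_poly (S : comNzRingType) (f : S) (n : nat) : {poly S} :=
  f%:P + 'X^n.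

(* [{poly %/ h}] silently replaces h by 'X unless h is monic of positive
   degree; this does not happen for [cover_poly f n] with n > 0. *)
Lemma mk_monic_cover_poly (S : comNzRingType) (f : S) (n : nat) :
  (0 < n)%N -> mk_monic (cover_poly f n) = cover_poly f n.
Proof.
move=> n_gt0.
have sz : (size f%:P < size ('X^n : {poly S}))%N.
  by rewrite size_polyXn ltnS (leq_trans (size_polyC_leq1 f)).
rewrite /mk_monic monicE /cover_poly addrC lead_coefDl // lead_coefXn eqxx.
by rewrite size_polyDl // size_polyXn ltnS n_gt0.
Qed.

(* Main.v *)
Require Import Defs.
From HB Require Import structures.
From mathcomp Require Import all_boot all_algebra.
From mathcomp Require Import boolp classical_sets.
From mathcomp Require Import ring.

Set Implicit Arguments.
Unset Strict Implicit.
Unset Printing Implicit Defensive.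

Import GRing.Theory.
Local Open Scope ring_scope.

(** Write R = S[y]/(f + y^n), x = y^(n-1), and let p : F -> N be a minimal free
    cover with kernel the first syzygy of N.  Since x lies in the maximal ideal
    of the local ring R, the composite F -> N -> N/xN is a minimal free cover
    as well ([minimal_cover_quotient]); its kernel is the preimage of xN under
    p, an extension of xN by the syzygy of N.  Multiplication by x identifies N
    with xN, and this extension becomes the pullback of F -> N along x, so it
    splits as soon as multiplication by x factors through p
    ([syzygy_quotient_split]).

    It does, because n x is the derivative of y^n + f.  If sigma is an S-linear
    section of p, then v |-> (1/n) sum_i y^i sigma (y^(n-1-i) v) commutes with
    y (the sum telescopes, up to two end terms that agree because y^n = -f lies
    in S), so it is R-linear, and composing it with p gives multiplication by x
    ([mul_pow_factors]).

    So everything rests on two facts: N is free over S, which gives sigma, and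
    f is a nonzerodivisor on N, which makes y one too.  Both come out of the
    Koszul complex of generators g_1, ..., g_d of the maximal ideal of S, where
    d = dim S.  Going up gives dim R >= d ([prime_chain_lift]), so the MCM
    module N, if not zero, has a regular sequence of length at least d in the
    maximal ideal of R.  Every element of that ideal has its n-th power in the
    ideal generated by the g_i, so it acts nilpotently on Koszul homology; the long
    exact sequence of 0 -> N -> N -> N/zN -> 0 then makes each term of the
    regular sequence kill one more homology group from the top, until
    H_i(g; N) = 0 for all i > 0 ([kexact_depth]).
    From H_1(g; N) = 0, which plays the part of Tor_1(k, N) = 0, Nakayama gives
    that N is free ([kexact_free]).  If N is not zero, S is a direct summand of
    it, so H_1(g; S) = 0; this makes g a regular sequence on S, and descending
    along g shows that S is a domain ([kexact_domain]), so that the nonzero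
    element f is a nonzerodivisor on the free module N. *)

(** * Local rings, submodules and Nakayama's lemma *)

Section LocalRings.
Variable R : comNzRingType.

Definition invertible (a : R) : Prop := exists b, a * b = 1.

(** Locality as additivity of the nonunits: in this form it passes to
    S[y]/(f + y^n) by inspection of constant terms. *)
Definition local_ring : Prop :=
  forall a b, invertible (a + b) -> invertible a \/ invertible b.

Lemma invertible1 : invertible 1.
Proof. by exists 1; rewrite mulr1. Qed.

Lemma not_invertible0 : ~ invertible 0.
Proof. by case=> b /eqP; rewrite mul0r eq_sym oner_eq0. Qed.

Lemma invertibleMl a b : invertible (a * b) -> invertible a.
Proof. by case=> c abc; exists (b * c); rewrite mulrA. Qed.

Lemma invertibleM a b : invertible a -> invertible b -> invertible (a * b).
Proof. by case=> c ac [d bd]; exists (c * d); rewrite mulrACA ac bd mulr1. Qed.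

End LocalRings.

Section Submodules.
Variables (R : comNzRingType) (V : lmodType R).
Implicit Types (A B L M : V -> Prop) (cs : seq R) (vs : seq V).

Definition submodule L : Prop :=
  L 0 /\ forall a u v, L u -> L v -> L (a *: u + v).

Lemma submoduleZ L a u : submodule L -> L u -> L (a *: u).
Proof. by case=> L0 LP Lu; rewrite -[_ *: _]addr0; apply: LP. Qed.

Lemma submoduleD L u v : submodule L -> L u -> L v -> L (u + v).
Proof. by case=> L0 LP Lu Lv; rewrite -[u]scale1r; apply: LP. Qed.

Lemma submoduleB L u v : submodule L -> L u -> L v -> L (u - v).
Proof.
by move=> LP Lu Lv; rewrite -scaleN1r addrC; apply: LP.2.
Qed.

(** The recursion on the list matches the inductions on generators in
    [nakayama] and in the construction of the Koszul complex. *)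
Fixpoint lin_span vs (u : V) : Prop :=
  if vs is v :: vs' then exists c, lin_span vs' (u - c *: v) else u = 0.

(** The set of combinations of elements of [A] with coefficients [cs]: the
    submodule (cs) A when [A] is a submodule. *)
Fixpoint ideal_mul cs A (u : V) : Prop :=
  if cs is c :: cs' then exists2 v, A v & ideal_mul cs' A (u - c *: v)
  else u = 0.

Lemma lin_span_sum (I : Type) (s : seq I) (c : I -> R) (v : I -> V) :
  lin_span [seq v i | i <- s] (\sum_(i <- s) c i *: v i).
Proof.
elim: s => [|i s IH] /=; first by rewrite big_nil.
by exists (c i); rewrite big_cons addrC addKr.
Qed.

Lemma ideal_mul_sum A (I : Type) (s : seq I) (c : I -> R) (v : I -> V) :
  (forall i, A (v i)) ->
  ideal_mul [seq c i | i <- s] A (\sum_(i <- s) c i *: v i).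
Proof.
move=> Av; elim: s => [|i s IH] /=; first by rewrite big_nil.
by exists (v i) => //; rewrite big_cons addrC addKr.
Qed.

Lemma ideal_mulS cs A B u : (forall v, A v -> B v) ->
  ideal_mul cs A u -> ideal_mul cs B u.
Proof.
move=> AB; elim: cs u => //= c cs IH u [v Av /IH h].
by exists v; first exact: AB.
Qed.

Lemma ideal_mul_submodule cs A : submodule A -> submodule (ideal_mul cs A).
Proof.
move=> AP; elim: cs => [|c cs IH] /=; first by split=> // a u w -> ->;
  rewrite scaler0 addr0.
split=> [|a u w [u' Au' uu'] [w' Aw' ww']].
  by exists 0; [exact: AP.1|rewrite scaler0 subr0; exact: IH.1].
exists (a *: u' + w'); first exact: AP.2.
rewrite scalerDr scalerA [c * a]mulrC -scalerA opprD addrACA -scalerBr.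
exact: IH.2.
Qed.

Lemma lin_span_submodule vs : submodule (lin_span vs).
Proof.
elim: vs => [|v vs [L0 LP]] /=; first by split=> // a u w -> ->;
  rewrite scaler0 addr0.
split=> [|a u w [c uc] [d wd]]; first by exists 0; rewrite scale0r subr0.
exists (a * c + d); rewrite scalerDl -scalerA opprD addrACA -scalerBr.
exact: LP.
Qed.

Lemma lin_spanW (g : V) vs u : lin_span vs u -> lin_span (g :: vs) u.
Proof. by exists 0; rewrite scale0r subr0. Qed.

Lemma lin_span_mem vs v : v \in vs -> lin_span vs v.
Proof.
elim: vs => //= w vs IH; rewrite inE => /orP[/eqP ->|/IH h].
  by exists 1; rewrite scale1r subrr; apply: (lin_span_submodule vs).1.
exact: (lin_spanW w h).
Qed.

Lemma lin_span_sub L vs : submodule L -> (forall v, v \in vs -> L v) ->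
  forall u, lin_span vs u -> L u.
Proof.
move=> LP; elim: vs => [|v vs IH] Lvs u /=; first by move->; exact: LP.1.
case=> c uc; rewrite -[u](subrK (c *: v)) addrC; apply: LP.2.
  by apply: Lvs; rewrite inE eqxx.
by apply: IH uc => w wvs; apply: Lvs; rewrite inE wvs orbT.
Qed.

(** M is generated by [vs] modulo L, and M = L + (nonunits) M.  Generators are
    removed one at a time: by induction M is contained in L + R g for the first
    generator g, and expanding the multiples of nonunits in g = l + sum c_i m_i
    gives (1 - a) g in L with a a nonunit.  The list of nonunits may depend on
    the element, so that the whole maximal ideal can be used even where no
    finite generating set of it is at hand. *)
Lemma nakayama L M vs : local_ring R -> submodule L -> submodule M ->
    (forall v, v \in vs -> M v) ->
    (forall u, M u -> exists2 l, L l & lin_span vs (u - l)) ->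
    (forall u, M u -> exists cs l,
       [/\ forall c, c \in cs -> ~ invertible c, L l
         & ideal_mul cs M (u - l)]) ->
  forall u, M u -> L u.
Proof.
move=> loc; elim: vs L => [|g vs IH] L LP MP Mvs gen small u Mu.
  by have [l Ll /= /eqP] := gen u Mu; rewrite subr_eq0 => /eqP ->.
pose L1 u := exists c, L (u - c *: g).
have L1P : submodule L1.
  split=> [|a v w [c vc] [d wd]]; first by exists 0;
    rewrite scale0r subr0; exact: LP.1.
  exists (a * c + d); rewrite scalerDl -scalerA opprD addrACA -scalerBr.
  exact: LP.2.
have LL1 v : L v -> L1 v by exists 0; rewrite scale0r subr0.
have ML1 : forall u, M u -> L1 u.
  apply: IH => // [v vvs|v Mv|v Mv].
  - by apply: Mvs; rewrite inE vvs orbT.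
  - have [l Ll [c vc]] := gen v Mv; exists (l + c *: g);
      last by rewrite opprD addrA.
    by exists c; rewrite addrK.
  - by have [cs [l [csn Ll h]]] := small v Mv; exists cs, l; split=> //;
      apply: LL1.
(* Modulo L, a combination of elements of M with nonunit coefficients is a
   nonunit multiple of g. *)
have absorb cs w : (forall c, c \in cs -> ~ invertible c) -> ideal_mul cs M w ->
    exists2 a, ~ invertible a & L (w - a *: g).
  elim: cs w => [|h cs IHcs] w csn /=.
    by move=> ->; exists 0; [exact: not_invertible0|rewrite scale0r subr0;
      exact: LP.1].
  case=> v /ML1[c vc] /IHcs[d dcs|a an wa].
    by apply: csn; rewrite inE dcs orbT.
  exists (h * c + a).
    case/loc => [/invertibleMl|//]; apply: csn; exact: mem_head.
  have -> : w - (h * c + a) *: g = h *: (v - c *: g) + (w - h *: v - a *: g).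
    by rewrite scalerBr scalerDl opprD scalerA [RHS]addrCA !addrA subrK.
  exact: LP.2.
have Lg : L g.
  have [cs [l [csn Ll /(absorb _ _ csn)[a an]]]]
    := small g (Mvs g (mem_head _ _)).
  have [b ab1] : invertible (1 - a).
    by have [||//] := loc (1 - a) a; [rewrite subrK; exact: invertible1|].
  move=> h; rewrite -[g]scale1r -ab1 mulrC -scalerA scalerBl scale1r.
  have -> : g - a *: g = l + (g - l - a *: g).
    by rewrite [RHS]addrA [l + _]addrC subrK.
  by apply: submoduleZ => //; apply: submoduleD.
have [c uc] := ML1 u Mu; rewrite -[u](subrK (c *: g)) addrC.
exact: LP.2.
Qed.

End Submodules.

Lemma fin_gen_span (R : comNzRingType) (V : lmodType R) :
  fin_gen V -> exists vs : seq V, forall u, lin_span vs u.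
Proof.
case=> r [g gen]; exists (codom g) => u; have [c ->] := gen u.
by rewrite -big_enum codomE; apply: lin_span_sum.
Qed.

(** * Noetherian modules *)

Definition noetherian_module (R : comNzRingType) (V : lmodType R) : Prop :=
  forall L : V -> Prop, submodule L ->
    exists2 vs : seq V, (forall v, v \in vs -> L v)
      & forall u, L u -> lin_span vs u.

Lemma noetherian_regular (R : comNzRingType) : noetherian R ->
  noetherian_module R^o.
Proof.
move=> noeth L [L0 LP]; pose I : {pred R^o} := fun u => `[< L u >].
have I_P : submod_closed I.
  split; first exact/asboolP.
  by move=> a u v /asboolP Lu /asboolP Lv; apply/asboolP; exact: LP.
have [r [g gen]] := noeth I I_P; exists (codom g).
  move=> _ /codomP[i ->]; have /asboolP : g i \in I; last by [].
  apply/gen; exists (fun j => (j == i)%:R).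
  rewrite (bigD1 i) //= eqxx scale1r big1 ?addr0 // => j /negPf ->.
  by rewrite scale0r.
move=> u Lu; have /gen[c ->] : u \in I by apply/asboolP.
by rewrite -big_enum codomE; apply: lin_span_sum.
Qed.

(** Generators of the first projection of a submodule are lifted, and completed
    by generators of its intersection with the second factor. *)
Lemma noetherian_pair (R : comNzRingType) (V W : lmodType R) :
  noetherian_module V -> noetherian_module W -> noetherian_module (V * W)%type.
Proof.
move=> nV nW L LP.
have [vs vsL vsP] : exists2 vs : seq V,
    (forall v, v \in vs -> exists w, L (v, w))
    & forall v, (exists w, L (v, w)) -> lin_span vs v.
  apply: nV; split=> [|a u v [w Luw] [w' Lvw]]; first by exists 0; exact: LP.1.
  by exists (a *: w + w'); exact: (LP.2 a _ _ Luw Lvw).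
have [ws wsL wsP] : exists2 ws : seq W, (forall w, w \in ws -> L (0, w))
    & forall w, L (0, w) -> lin_span ws w.
  apply: nW; split=> [|a u v Lu Lv]; first exact: LP.1.
  by have := LP.2 a _ _ Lu Lv; congr L; congr pair; rewrite /= scaler0 addr0.
have [us usL usP] : exists2 us : seq (V * W), (forall u, u \in us -> L u)
    & forall u, L u -> exists2 u', lin_span us u' & u'.1 = u.1.
  have {}vsP u : L u -> lin_span vs u.1.
    by case: u => v w Lvw; apply: vsP; exists w.
  suff [us usL usP] : exists2 us : seq (V * W), (forall u, u \in us -> L u)
      & forall v, lin_span vs v -> exists2 u', lin_span us u' & u'.1 = v.
    by exists us => // u /vsP/usP.
  elim: vs vsL {vsP} => [|v vs IH] vsL.
    by exists [::] => // v /= ->; exists 0.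
  have [us usL usP] := IH (fun v' h => vsL v' (mem_behead (s := v :: vs) h)).
  have [w Lvw] := vsL v (mem_head _ _).
  exists ((v, w) :: us) => [u|v' [c /usP[u' us_u' u'E]]].
    by rewrite inE => /orP[/eqP ->|/usL].
  exists (u' + c *: (v, w)); last by rewrite /= u'E subrK.
  by exists c; rewrite addrK.
pose emb (w : W) : V * W := (0, w).
exists (us ++ map emb ws) => [u|u Lu].
  by rewrite mem_cat => /orP[/usL //|/mapP[w /wsL Lw ->]].
have [u' us_u' u'E] := usP u Lu.
have catL x : lin_span us x -> lin_span (us ++ map emb ws) x.
  apply: lin_span_sub; first exact: lin_span_submodule.
  by move=> y yus; apply: lin_span_mem; rewrite mem_cat yus.
have catR w : lin_span ws w -> lin_span (us ++ map emb ws) (emb w).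
  have [S0 SP] := lin_span_submodule (us ++ map emb ws).
  apply: (@lin_span_sub _ _ (fun w => lin_span _ (emb w))) => [|y yws].
    split=> // a x y Sx Sy; have := SP a _ _ Sx Sy; congr lin_span.
    by congr pair; rewrite /= scaler0 addr0.
  by apply: lin_span_mem; rewrite mem_cat map_f // orbT.
have -> : u = u' + emb (u.2 - u'.2).
  by rewrite [LHS]surjective_pairing; congr pair;
    rewrite /= ?addr0 ?u'E // addrC subrK.
apply: submoduleD; [exact: lin_span_submodule|exact: catL|].
apply/catR/wsP; have -> : (0, u.2 - u'.2) = u - u'.
  by congr pair; rewrite /= u'E subrr.
apply: submoduleB => //; exact: lin_span_sub us_u'.
Qed.

(** * The Koszul complex *)

(** The Koszul complex of g :: gs is the mapping cone of multiplication by g on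
    that of gs; the pair (a, b) stands for a + e_g b.  All degrees are kept in
    one module, so that the complex of gs on M is M^(2^d). *)
Fixpoint koszul (S : comNzRingType) (M : lmodType S) (gs : seq S) :
    lmodType S :=
  if gs is _ :: gs' then (koszul M gs' * koszul M gs')%type else M.

Section KoszulComplex.
Variables (S : comNzRingType) (M : lmodType S).

Fixpoint kdiff (gs : seq S) : koszul M gs -> koszul M gs :=
  if gs is g :: gs' then fun w => (kdiff w.1 + g *: w.2, - kdiff w.2)
  else fun=> 0.

(** Homogeneity of degree i; zero is homogeneous of every degree. *)
Fixpoint kdeg (gs : seq S) (i : nat) : koszul M gs -> Prop :=
  if gs is g :: gs' then fun w =>
    kdeg i w.1 /\ (if i is j.+1 then kdeg j w.2 else w.2 = 0)
  else fun w => if i is 0 then True else w = 0.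

(** The identification of M with the part of degree 0. *)
Fixpoint kinj (gs : seq S) : M -> koszul M gs :=
  if gs is g :: gs' then fun u => (kinj gs' u, 0) else id.

Lemma kdiff_linear gs : linear (@kdiff gs).
Proof.
elim: gs => [|g gs IH] /= a u v; first by rewrite scaler0 addr0.
congr pair; rewrite /= IH ?scalerDr ?opprD ?scalerN // !scalerA.
by rewrite [g * a]mulrC addrACA.
Qed.

HB.instance Definition _ gs :=
  GRing.isLinear.Build S (koszul M gs) (koszul M gs) _ (@kdiff gs)
    (@kdiff_linear gs).

Lemma kdiff_cons g gs (u v : koszul M gs) :
  @kdiff (g :: gs) (u, v) = (kdiff u + g *: v, - kdiff v).
Proof. by []. Qed.

Lemma kinj_linear gs : linear (@kinj gs).
Proof.
elim: gs => //= g gs IH a u v; rewrite IH.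
by congr pair; rewrite /= scaler0 addr0.
Qed.

HB.instance Definition _ gs :=
  GRing.isLinear.Build S M (koszul M gs) _ (@kinj gs) (@kinj_linear gs).

Lemma kdiff_kdiff gs (w : koszul M gs) : kdiff (kdiff w) = 0.
Proof.
elim: gs w => //= g gs IH w.
congr pair => /=; last by rewrite linearN /= IH !oppr0.
by rewrite linearD linearZ /= IH add0r scalerN subrr.
Qed.

Lemma kdeg_submodule gs i : submodule (@kdeg gs i).
Proof.
elim: gs i => [|g gs IH] i /=.
  by case: i => [|i]; split=> // a u v -> ->; rewrite scaler0 addr0.
have [D0 DP] := IH i; split.
  by case: i {D0 DP} => [|i]; split=> //=; apply: (IH _).1.
move=> a u v [u1 u2] [v1 v2]; split; first exact: DP.
case: i u2 v2 {D0 DP u1 v1} => [|i] /=; last exact: (IH i).2.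
by move=> -> ->; rewrite scaler0 addr0.
Qed.

Lemma kdiff_kdeg0 gs (w : koszul M gs) : kdeg 0 w -> kdiff w = 0.
Proof.
elim: gs w => //= h gs IH w [w1 ->].
by rewrite IH // scaler0 addr0 linear0 oppr0.
Qed.

Lemma kdeg_kdiff gs i (w : koszul M gs) : kdeg i.+1 w -> kdeg i (kdiff w).
Proof.
elim: gs i w => [|g gs IH] i w /=; first by case: i.
case=> w1 w2; split.
  by apply: submoduleD (kdeg_submodule _ _) (IH _ _ w1) _;
    apply: submoduleZ (kdeg_submodule _ _) _.
case: i w1 w2 => [|i] _ w2; last first.
  by rewrite -scaleN1r; apply: submoduleZ (kdeg_submodule _ _) _; apply: IH.
by rewrite /= kdiff_kdeg0 ?oppr0.
Qed.

Lemma kdeg_gt gs i (w : koszul M gs) : (size gs < i)%N -> kdeg i w -> w = 0.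
Proof.
elim: gs i w => [|g gs IH] [|i] //= w lt_i [w1 w2].
by rewrite [w]surjective_pairing (IH _ _ _ w1) ?(IH _ _ _ w2) // ltnW.
Qed.

Lemma kdeg_kinj gs u : kdeg 0 (kinj gs u).
Proof. by elim: gs => //= g gs IH; split. Qed.

Lemma kdeg0P gs (w : koszul M gs) : kdeg 0 w -> exists u, w = kinj gs u.
Proof.
elim: gs w => [|g gs IH] /= w; first by exists w.
by case=> /IH[u w1 w2]; exists u; rewrite [LHS]surjective_pairing w1 w2.
Qed.

Lemma kinj_inj gs : injective (@kinj gs).
Proof. by elim: gs => [|g gs IH] u v /= => [|[/IH]]. Qed.

(** Vanishing of the i-th Koszul homology of M. *)
Definition kexact (gs : seq S) (i : nat) : Prop :=
  forall w : koszul M gs, kdeg i w -> kdiff w = 0 ->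
    exists2 z : koszul M gs, kdeg i.+1 z & kdiff z = w.

(** The homotopy is exterior multiplication by the basis vector e_g; the sign in
    the second component comes from moving it past e_h. *)
Lemma khomotopy gs g : g \in gs ->
  exists s : koszul M gs -> koszul M gs,
    [/\ linear s, forall i w, kdeg i w -> kdeg i.+1 (s w)
      & forall w, kdiff (s w) + s (kdiff w) = g *: w].
Proof.
elim: gs => //= h gs IH; rewrite inE;
  case: eqP => [-> _|_ /= /IH[s [sL sdeg sP]]].
  exists (fun w => (0, w.1)); split=> [a u v|i w [w1 w2]|w].
  - by congr pair; rewrite /= scaler0 addr0.
  - by split=> //=; apply: (kdeg_submodule _ _).1.
  rewrite /= linear0 add0r; congr pair; rewrite /= ?addr0 //.
  by rewrite addrA addNr add0r.
have sN u v : s (u - v) = s u - s v.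
  by rewrite addrC -scaleN1r sL scaleN1r addrC.
have s0 : s 0 = 0 by have := sN 0 0; rewrite !subrr.
have sZ a u : s (a *: u) = a *: s u by rewrite -[_ *: _]addr0 sL s0 addr0.
have sD u v : s (u + v) = s u + s v by rewrite -[u]scale1r sL !scale1r.
exists (fun w => (s w.1, - s w.2)); split=> [a u v|i w [w1 w2]|w].
- by congr pair; rewrite /= sL // opprD scalerN.
- split=> /=; first exact: sdeg.
  rewrite -scaleN1r; apply: submoduleZ (kdeg_submodule _ _) _.
  case: i w1 w2 => [|i] _ w2; last exact: sdeg.
  by rewrite w2 s0; apply: (kdeg_submodule _ _).1.
congr pair; rewrite /=.
  by rewrite sD sZ scalerN addrACA sP addNr addr0.
by rewrite linearN /= opprK -[- kdiff w.2]sub0r sN s0 sub0r opprK sP.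
Qed.

Lemma kboundary_submodule gs i :
  submodule (fun w : koszul M gs => exists2 z, kdeg i z & kdiff z = w).
Proof.
split; first by exists 0; [exact: (kdeg_submodule _ _).1|exact: linear0].
move=> a _ _ [u ui <-] [v vi <-]; exists (a *: u + v); last by rewrite linearP.
exact: (kdeg_submodule _ _).2.
Qed.

(** A homotopy from multiplication by c to 0 turns c times a cycle into a
    boundary: the ideal generated by gs kills Koszul homology. *)
Lemma kexact_ideal gs c i (w : koszul M gs) :
  @lin_span S S^o gs c -> kdeg i w -> kdiff w = 0 ->
  exists2 z, kdeg i.+1 z & kdiff z = c *: w.
Proof.
move=> cgs wi dw.
pose B (c : S^o) := exists2 z, kdeg i.+1 z & kdiff z = c *: w.
apply: (@lin_span_sub _ S^o B) cgs.
  have [B0 BP] := kboundary_submodule gs i.+1; rewrite /B.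
  split; first by rewrite scale0r.
  move=> a u v /(BP a)h /h{h}; rewrite scalerDl -scalerA; exact.
move=> g /khomotopy[s [sL sdeg sP]]; exists (s w); first exact: sdeg.
have s0 : s 0 = 0.
  by have := sL (-1) 0 0; rewrite !scaleN1r oppr0 add0r addNr.
by rewrite -sP dw s0 addr0.
Qed.

(** The boundaries of degree 0 are (gs) M; [kdiff_ideal_mul] below is the
    converse, with a control on where the coefficients lie. *)
Lemma ideal_mul_kdiff gs u : ideal_mul gs (fun _ : M => True) u ->
  exists2 w : koszul M gs, kdeg 1 w & kdiff w = kinj gs u.
Proof.
elim: gs u => [|g gs IH] u /=; first by exists 0.
case=> v _ /IH[w w1 dw]; exists (w, kinj gs v).
  by split=> //; apply: kdeg_kinj.
congr pair; rewrite /= ?dw -?linearZ /= -?linearD /= ?subrK //.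
by rewrite kdiff_kdeg0 ?oppr0 //; apply: kdeg_kinj.
Qed.

End KoszulComplex.

(** * Functoriality and the long exact sequence *)

Section KoszulMap.
Variables (S : comNzRingType).

Fixpoint kmap (M N : lmodType S) (h : {linear M -> N}) (gs : seq S) :
    koszul M gs -> koszul N gs :=
  if gs is g :: gs' then fun w => (kmap h w.1, kmap h w.2) else h.

Arguments kmap {M N} h {gs} w.

Lemma kmap_linear (M N : lmodType S) (h : {linear M -> N}) gs :
  linear (@kmap M N h gs).
Proof.
elim: gs => [|g gs IH] /= a u v; first exact: linearP.
by congr pair; rewrite /= IH.
Qed.

HB.instance Definition _ M N h gs :=
  GRing.isLinear.Build S (koszul M gs) (koszul N gs) _ (@kmap M N h gs)
    (@kmap_linear M N h gs).

Lemma kdiff_kmap (M N : lmodType S) (h : {linear M -> N}) gs (w : koszul M gs) :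
  kdiff (kmap h w) = kmap h (kdiff w).
Proof.
elim: gs w => [|g gs IH] /= w; first by rewrite linear0.
by rewrite linearD linearZ linearN !IH.
Qed.

Lemma kdeg_kmap (M N : lmodType S) (h : {linear M -> N}) gs i
    (w : koszul M gs) :
  kdeg i w -> kdeg i (kmap h w).
Proof.
elim: gs i w => [|g gs IH] i w /=; first by case: i => // i ->; rewrite linear0.
case=> w1 w2; split; first exact: IH.
by case: i w1 w2 => [_ ->|i _ /IH //]; rewrite linear0.
Qed.

Lemma kmap_kinj (M N : lmodType S) (h : {linear M -> N}) gs u :
  kmap h (kinj gs u) = kinj gs (h u).
Proof. by elim: gs => //= g gs ->; rewrite linear0. Qed.

(** The complex is a direct sum of copies of the module in each degree, so
    surjectivity passes to it; the next two lemmas transfer exactness and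
    injectivity for the same reason. *)
Lemma kmap_lift (M N : lmodType S) (h : {linear M -> N}) gs i
    (w : koszul N gs) :
  surjective_map h -> kdeg i w -> exists2 z, kdeg i z & kmap h z = w.
Proof.
move=> h_surj; elim: gs i w => [|g gs IH] i w /=.
  have [u hu] := h_surj w; case: i => [_|i ->]; first by exists u.
  by exists 0; rewrite ?linear0.
case=> /IH[z1 z1i z1w] w2.
have [z2 z2i z2w] : exists2 z2,
    (if i is j.+1 then kdeg j z2 else z2 = 0) & kmap h z2 = w.2.
  by case: i w2 {z1i} => [->|i /IH //]; exists 0; rewrite ?linear0.
by exists (z1, z2); rewrite //= z1w z2w -surjective_pairing.
Qed.

Lemma kmap_ker (L M N : lmodType S) (k : {linear L -> M}) (h : {linear M -> N})
    gs i (w : koszul M gs) :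
  (forall u, h u = 0 -> exists v, k v = u) ->
  kdeg i w -> kmap h w = 0 -> exists2 z, kdeg i z & kmap k z = w.
Proof.
move=> hk; elim: gs i w => [|g gs IH] i w /=.
  move=> w0 /hk[v kv]; case: i w0 => [_|i w0]; first by exists v.
  by exists 0; rewrite ?linear0.
case=> w1 w2 hw; have /IH[//|z1 z1i z1w] := w1; first exact: (congr1 fst hw).
have [z2 z2i z2w] : exists2 z2,
    (if i is j.+1 then kdeg j z2 else z2 = 0) & kmap k z2 = w.2.
  case: i w2 {w1 z1i} => [->|i /IH]; first by exists 0; rewrite ?linear0.
  by apply; exact: (congr1 snd hw).
by exists (z1, z2); rewrite //= z1w z2w -surjective_pairing.
Qed.

Lemma kmap_inj (M N : lmodType S) (h : {linear M -> N}) gs :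
  injective h -> injective (@kmap M N h gs).
Proof.
move=> h_inj; elim: gs => //= g gs IH u v uv.
rewrite [u]surjective_pairing [v]surjective_pairing.
by congr pair; apply: IH; [exact: (congr1 fst uv)|exact: (congr1 snd uv)].
Qed.

Lemma kmap_comp (L M N : lmodType S) (h : {linear M -> N}) (k : {linear L -> M})
    (f : {linear L -> N}) gs (w : koszul L gs) :
  (forall u, f u = h (k u)) -> kmap f w = kmap h (kmap k w).
Proof. by move=> fE; elim: gs w => //= g gs IH w; rewrite !IH. Qed.

Lemma kmap_comb (M N : lmodType S) (f h k : {linear M -> N}) a b gs
    (w : koszul M gs) :
  (forall u, f u = a *: h u + b *: k u) ->
  kmap f w = a *: kmap h w + b *: kmap k w.
Proof. by move=> fE; elim: gs w => //= g gs IH w; rewrite !IH. Qed.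

Lemma kmap_id (M : lmodType S) (h : {linear M -> M}) gs (w : koszul M gs) :
  (forall u, h u = u) -> kmap h w = w.
Proof.
by move=> hE; elim: gs w => //= g gs IH w; rewrite !IH -surjective_pairing.
Qed.

Lemma kexact_retract (L M : lmodType S) (k : {linear L -> M})
    (h : {linear M -> L}) gs i :
  (forall u, h (k u) = u) -> kexact M gs i -> kexact L gs i.
Proof.
move=> hk ex w wi dw; have [|z zi dz] := ex _ (kdeg_kmap k wi).
  by rewrite kdiff_kmap dw linear0.
exists (kmap h z); first exact: kdeg_kmap.
by rewrite kdiff_kmap dz -(@kmap_comp _ _ _ _ _ idfun) ?kmap_id.
Qed.

(** The piece H_(i+1)(N) -> H_i(M) -> H_i(M) of the long exact sequence of
    0 -> M -> M -> N -> 0, whose first map is [x].  If H_(i+1)(N) = 0, then [x]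
    is injective on H_i(M); as it is also nilpotent there, H_i(M) = 0. *)
Lemma kexact_coker (M N : lmodType S) (x : {linear M -> M})
    (p : {linear M -> N}) gs i n :
  injective x -> surjective_map p ->
  (forall u, p u = 0 <-> exists v, x v = u) ->
  (forall w : koszul M gs, kdeg i w -> kdiff w = 0 ->
     exists2 z, kdeg i.+1 z & kdiff z = iter n (kmap x) w) ->
  kexact N gs i.+1 -> kexact M gs i.
Proof.
move=> x_inj p_surj px nil ex w wi dw.
(* It suffices that a cycle is a boundary as soon as its image under [x] is:
   apply this n times. *)
suff descend (v : koszul M gs) : kdeg i v -> kdiff v = 0 ->
    (exists2 z, kdeg i.+1 z & kdiff z = kmap x v) ->
    exists2 z, kdeg i.+1 z & kdiff z = v.
  elim: n {nil}(nil w wi dw) => [//|n IH] h; apply: IH.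
  have [iw diw] : kdeg i (iter n (kmap x) w) /\ kdiff (iter n (kmap x) w) = 0.
    elim: n {h} => //= n [iw diw]; split; first exact: kdeg_kmap.
    by rewrite kdiff_kmap diw linear0.
  exact: descend.
move=> vi dv [z zi dz].
(* If x v is the boundary of z, the image of z in N is a cycle, hence the
   boundary of some t; correcting z by a lift of t makes it divisible by x. *)
have [|t ti dt] := ex _ (kdeg_kmap p zi).
  rewrite kdiff_kmap dz;
    elim: gs v {vi dv z zi dz ex w wi dw nil} => [|g gs IH] v /=.
    by apply/px; exists v.
  by rewrite !IH.
have [t' t'i t't] := kmap_lift p_surj ti.
have [|||q qi qE] := @kmap_ker _ _ _ x p gs i.+1 (z - kdiff t').
- by move=> u /px.
- by apply: submoduleB (kdeg_submodule _ _ _) zi _; apply: kdeg_kdiff.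
- by rewrite linearB /= -kdiff_kmap t't dt subrr.
exists q => //; apply: (kmap_inj x_inj).
by rewrite -kdiff_kmap qE linearB /= kdiff_kdiff subr0.
Qed.

Lemma kdiff_ideal_mul (M N : lmodType S) (h : {linear M -> N}) gs u
    (w : koszul M gs) :
  kdeg 1 w -> kmap h w = 0 -> kdiff w = kinj gs u ->
  ideal_mul gs (fun v => h v = 0) u.
Proof.
elim: gs u w => [|g gs IH] u w /=; first by move=> _ _ ->.
case=> w1 /kdeg0P[v w2] hw dw; exists v.
  apply: (@kinj_inj _ _ gs); rewrite linear0 -kmap_kinj -w2.
  exact: (congr1 snd hw).
apply: (IH _ w.1) => //; first exact: (congr1 fst hw).
by have := congr1 fst dw; rewrite /= w2 linearB linearZ /= => <-; rewrite addrK.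
Qed.

(** The snake lemma for 0 -> K -> M -> N -> 0: when H_1(N) = 0, the map
    K/(gs)K -> M/(gs)M is injective. *)
Lemma ideal_mul_ker (M N : lmodType S) (h : {linear M -> N}) gs u :
  surjective_map h -> kexact N gs 1 -> h u = 0 ->
  ideal_mul gs (fun=> True) u -> ideal_mul gs (fun v => h v = 0) u.
Proof.
move=> h_surj ex hu /ideal_mul_kdiff[w w1 dw].
have [|z z2 dz] := ex _ (kdeg_kmap h w1).
  by rewrite kdiff_kmap dw kmap_kinj hu linear0.
have [t t2 tz] := kmap_lift h_surj z2.
apply: (@kdiff_ideal_mul _ _ _ _ _ (w - kdiff t)).
- by apply: submoduleB (kdeg_submodule _ _ _) w1 _; apply: kdeg_kdiff.
- by rewrite linearB /= -kdiff_kmap tz dz subrr.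
- by rewrite linearB /= kdiff_kdiff subr0.
Qed.

(** In the long exact sequence of the cone, H_1(g :: gs) maps onto the kernel of
    g on M/(gs)M. *)
Lemma kexact_regular (M : lmodType S) g gs (u : M) :
  kexact M (g :: gs) 1 -> ideal_mul gs (fun=> True) (g *: u) ->
  ideal_mul gs (fun=> True) u.
Proof.
move=> ex /ideal_mul_kdiff[w w1 dw].
have [||[c e] [c2 e1]] := ex (- w, kinj gs u).
- split; last exact: kdeg_kinj.
  by rewrite -scaleN1r; apply: submoduleZ (kdeg_submodule _ _ _) _.
- rewrite kdiff_cons linearN /= dw linearZ addNr kdiff_kdeg0 ?oppr0 //.
  exact: kdeg_kinj.
rewrite kdiff_cons => -[_ de].
have : ideal_mul gs (fun v : M => (\0 : {linear M -> M}) v = 0) (- u).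
  apply: (@kdiff_ideal_mul _ _ _ _ _ e) => //;
    last by rewrite linearN /= -de opprK.
  by elim: gs e {w w1 dw c c2 e1 de ex} => //= h gs IH e; rewrite !IH.
have JP : submodule (ideal_mul gs (fun _ : M => True)).
  exact: ideal_mul_submodule.
move/(ideal_mulS (B := fun=> True) (fun _ _ => I)) => /(submoduleZ (-1) JP).
by rewrite scaleN1r opprK.
Qed.

(** The same long exact sequence shows that g acts surjectively on H_1(gs),
    which vanishes by Nakayama since the cycles are finitely generated. *)
Lemma kexact_tail (M : lmodType S) g gs :
  local_ring S -> ~ invertible g -> noetherian_module (koszul M gs) ->
  kexact M (g :: gs) 1 -> kexact M gs 1.
Proof.
move=> loc gn noeth ex w w1 dw.
pose Z (z : koszul M gs) := kdeg 1 z /\ kdiff z = 0.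
have ZP : submodule Z.
  split; first by split; [exact: (kdeg_submodule _ _ _).1|exact: linear0].
  move=> a u v [u1 du] [v1 dv]; split; first exact: (kdeg_submodule _ _ _).2.
  by rewrite linearP /= du dv scaler0 addr0.
have [vs vsZ gen] := noeth Z ZP.
have [B0 BP] := kboundary_submodule M gs 2.
apply: (nakayama loc (conj B0 BP) ZP vsZ) => // [u Zu|u [u1 du]].
  by exists 0; rewrite ?subr0; [exact: B0|exact: gen].
have [||[c e] [c2 e1]] := ex (u, 0).
- by split=> //; apply: (kdeg_submodule _ _ _).1.
- by rewrite kdiff_cons du scaler0 addr0 linear0 oppr0.
rewrite kdiff_cons => -[dc de].
exists [:: g], (kdiff c); split=> [h|| /=].
- by rewrite inE => /eqP ->.
- by exists c.
exists e; first by split=> //; rewrite -[kdiff e]opprK de oppr0.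
by rewrite -dc -addrA -opprD subrr.
Qed.

End KoszulMap.
Arguments kmap {S M N} h {gs} w.

(** * Vanishing of H_1 at generators of the maximal ideal *)

Lemma linear_pack (R : comNzRingType) (U V : lmodType R) (h : U -> V) :
  linear h -> exists h' : {linear U -> V}, h' =1 h.
Proof.
move=> hL;
  pose H : {linear U -> V} := HB.pack h (GRing.isLinear.Build R U V _ h hL).
by exists H.
Qed.

Lemma linear_inverse (R : comNzRingType) (U V : lmodType R)
    (h : {linear U -> V}) :
  bijective h -> exists h' : {linear V -> U}, cancel h h' /\ cancel h' h.
Proof.
case=> k hk kh; have [|k' k'E] := @linear_pack _ _ _ k.
  by move=> a u v; apply: (can_inj hk); rewrite linearP !kh.
by exists k'; split=> u; rewrite k'E.
Qed.

(** A relation with an invertible coefficient expresses one generator through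
    the others, and a cover of smaller rank results. *)
Lemma minimal_cover_ker (R : comNzRingType) (X : lmodType R) r
    (e : {linear 'rV[R]_r -> X}) u i :
  minimal_free_cover e -> e u = 0 -> ~ invertible (u 0 i).
Proof.
case: r e u i => [|r] e u i [e_surj e_min] eu; first by case: i.
case=> b ub; pose g j := e (delta_mx 0 (lift i j)).
suff /e_min : surjective_map (free_map g : {linear _ -> _}) by rewrite ltnn.
move=> x; have [w <-] := e_surj x.
pose w' := w - (w 0 i * b) *: u; exists (\row_j w' 0 (lift i j)).
have <- : e w' = e w by rewrite linearB linearZ /= eu scaler0 subr0.
rewrite [in RHS](row_sum_delta w') linear_sum (bigD1_ord i) //= linearZ /=.
have -> : w' 0 i = 0 by rewrite !mxE -mulrA [b * _]mulrC ub mulr1 subrr.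
rewrite scale0r add0r; apply: eq_bigr => j _.
by rewrite linearZ /g /= [(\row_ _ _) _ _]mxE.
Qed.

Section RegularParameters.
Variables (S : comNzRingType) (gs : seq S).
Hypotheses (S_local : local_ring S) (S_noeth : noetherian_module S^o).
Hypothesis gs_small : forall g, g \in gs -> ~ invertible g.
Hypothesis gs_gen : forall a : S, ~ invertible a -> @lin_span S S^o gs a.

Lemma ideal_mul_row r (u : 'rV[S]_r) (cs : seq S) :
  (forall i, @lin_span S S^o cs (u 0 i)) -> ideal_mul cs (fun=> True) u.
Proof.
elim: cs u => [|c cs IH] u /= span_u; first by apply/rowP => i;
  rewrite span_u mxE.
have [d dP] := choice span_u.
exists (\row_i d i) => //; apply: IH => i.
by rewrite !mxE mulrC; exact: dP.
Qed.

Lemma ideal_mul_image (U V : lmodType S) (h : U -> V) (A : U -> Prop)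
    (B : V -> Prop) cs u :
  linear h -> (forall v, A v -> B (h v)) ->
  ideal_mul cs A u -> ideal_mul cs B (h u).
Proof.
move=> hL AB; elim: cs u => [|c cs IH] u /=.
  by move->; have := hL (-1) 0 0; rewrite !scaleN1r oppr0 add0r addNr.
case=> v Av /IH h_uv; exists (h v); first exact: AB.
by have := hL (- c) v u; rewrite !scaleNr [- _ + u]addrC [RHS]addrC => <-.
Qed.

(** Let A be the kernel of a minimal free cover S^k -> N.  Its vectors have
    nonunit entries, so A is contained in (gs) S^k, hence in (gs) A by
    [ideal_mul_ker].  For each coordinate, the ideal of the entries of vectors
    of A therefore satisfies Z = (gs) Z; it is finitely generated as S is
    Noetherian, so Nakayama makes it zero. *)
Lemma kexact_free (N : lmodType S) : fin_gen N -> kexact N gs 1 ->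
  exists k (e : {linear 'rV[S]_k -> N}), bijective e.
Proof.
move=> fgN ex; have [k [e e_cover]] := minimal_free_cover_exists fgN.
have e_surj := e_cover.1.
exists k, e; have e_ker u : e u = 0 -> u = 0.
  move=> eu; apply/rowP => i; rewrite mxE.
  pose Z (x : S^o) := exists2 v, e v = 0 & v 0 i = x.
  have ZP : submodule Z.
    split=> [|a _ _ [v ev <-] [w ew <-]]; first by exists 0;
      rewrite ?linear0 ?mxE.
    exists (a *: v + w); last by rewrite !mxE.
    by rewrite linearP ev ew scaler0 addr0.
  have [vs vsZ gen] := S_noeth ZP.
  apply: (nakayama (L := fun x : S^o => x = 0) S_local _ ZP vsZ);
    last by exists u.
  - by split=> // a x y -> ->; rewrite scaler0 addr0.
  - by move=> x Zx; exists 0; rewrite ?subr0 //; apply: gen.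
  move=> _ [v ev <-]; exists gs, 0; split=> //.
  rewrite subr0;
    apply: (@ideal_mul_image 'rV[S]_k S^o (fun v => v 0 i)
      (fun v => e v = 0) Z).
  - by move=> a x y; rewrite !mxE.
  - by move=> x ex0; exists x.
  apply: ideal_mul_ker => //; apply: ideal_mul_row => j.
  by apply: gs_gen; apply: minimal_cover_ker ev.
have e_inj : injective e.
  by move=> u v /eqP; rewrite -subr_eq0 -linearB => /eqP/e_ker/eqP;
    rewrite subr_eq0 => /eqP.
have [e1 e1K] := choice e_surj.
by exists e1 => // u; apply: e_inj; rewrite e1K.
Qed.

Let J (cs : seq S) (a : S) := ideal_mul cs (fun _ : S^o => True) a.

Lemma lin_span_ideal_mul cs (a : S) : @lin_span S S^o cs a <-> J cs a.
Proof.
elim: cs a => //= c cs IH a; split=> [[b ab]|[b _ ab]]; exists b => //.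
  by apply/IH; rewrite /GRing.scale /= mulrC.
by apply/IH; rewrite /GRing.scale /= mulrC.
Qed.

Let J_submodule cs : submodule (J cs : S^o -> Prop).
Proof. exact: ideal_mul_submodule. Qed.

(** If (g :: cs) is prime and g is regular modulo (cs), then (cs) is prime.  Let
    a b lie in J = (cs).  Whenever the colon ideal (J : a) is contained in
    J + (g), regularity of g gives (J : a) = J + g (J : a), and Nakayama gives
    (J : a) = J.  The inclusion holds when a is not in J + (g), by primality of
    the latter.  In the remaining case a and b both lie in J + (g), and if some
    c with a c in J did not, the first case applied to c would put a in J; so
    the inclusion holds again. *)
Lemma prime_descent g cs : ~ invertible g -> kexact S^o (g :: cs) 1 ->
  (forall a b, J (g :: cs) (a * b) -> J (g :: cs) a \/ J (g :: cs) b) ->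
  forall a b, J cs (a * b) -> J cs a \/ J cs b.
Proof.
move=> gn ex prime_g.
have J_cons a : J cs a -> J (g :: cs) a.
  by move=> Ja; exists 0; rewrite // scaler0 subr0.
have colon a : (forall b, J cs (a * b) -> J (g :: cs) b) ->
    forall b, J cs (a * b) -> J cs b.
  move=> sub; pose M (b : S^o) := J cs (a * b).
  have MP : submodule M.
    split=> [|c u v Mu Mv]; first by rewrite /M mulr0;
      exact: (J_submodule cs).1.
    have := (J_submodule cs).2 c _ _ Mu Mv; congr (J cs).
    by rewrite /GRing.scale /= mulrDr mulrCA.
  have [vs vsM gen] := S_noeth MP.
  apply: (nakayama S_local (J_submodule cs) MP vsM) => [b Mb|b Mb].
    by exists 0; [exact: (J_submodule cs).1|rewrite subr0; exact: gen].
  have [c _ bc] := sub b Mb.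
  exists [:: g], (b - g *: c); split=> [h||]; first by rewrite inE => /eqP ->.
    exact: bc.
  exists c; last by rewrite opprB addrCA subrr addr0 subrr.
  apply: (kexact_regular ex); rewrite -/(J cs _).
  have -> : g *: (a * c : S^o) = a * b - a *: (b - g *: c : S^o).
    by rewrite /GRing.scale /= mulrBr opprB addrCA subrr addr0 mulrCA.
  apply: (submoduleB (J_submodule cs)) => //;
    exact: (submoduleZ a (J_submodule cs) bc).
move=> a b Jab; apply: contrapT => /not_orP[nJa nJb].
have in_g x y : J cs (x * y) -> ~ J cs y -> J (g :: cs) x.
  move=> Jxy nJy; apply: contrapT => nJx; apply: nJy.
  apply: (colon x) Jxy => z Jxz.
  by have [|//|//] := prime_g x z; first exact: J_cons.
apply: nJb; apply: (colon a) Jab => c Jac.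
by apply: (in_g c a); rewrite // mulrC.
Qed.

(** The descent starts at the full list, which generates the maximal ideal, and
    ends at the empty list, which generates the zero ideal. *)
Lemma kexact_domain : kexact S^o gs 1 ->
  forall a b : S, a * b = 0 -> a = 0 \/ b = 0.
Proof.
move=> ex.
have prime_gs a b : J gs (a * b) -> J gs a \/ J gs b.
  move=> Jab; have gens x : ~ invertible x -> J gs x.
    by move=> xn; apply/lin_span_ideal_mul; apply: gs_gen.
  apply: contrapT => /not_orP[nJa nJb].
  have ia : invertible a by apply: contrapT => /gens.
  have ib : invertible b by apply: contrapT => /gens.
  have [c abc] := invertibleM ia ib.
  have J1 : J gs 1.
    by rewrite -abc mulrC; exact: (submoduleZ c (J_submodule gs) Jab).
  apply: nJa; rewrite -[a]mulr1; exact: (submoduleZ a (J_submodule gs) J1).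
have noethK (cs : seq S) : noetherian_module (koszul S^o cs).
  by elim: cs => //= c cs IH; apply: noetherian_pair.
have {prime_gs} : forall a b, J [::] (a * b) -> J [::] a \/ J [::] b;
  last by [].
elim: gs gs_small ex prime_gs => // g cs IH small ex prime_g.
have gn : ~ invertible g by apply: small; exact: mem_head.
apply: IH => [h hcs||]; first by apply: small; rewrite inE hcs orbT.
  exact: kexact_tail ex.
exact: prime_descent prime_g.
Qed.

(** When N is not zero, the inclusion of a basis vector makes S a retract of N,
    and S inherits the vanishing of H_1. *)
Lemma kexact_torsion_free (N : lmodType S) (f : S) : fin_gen N ->
  kexact N gs 1 -> f != 0 -> forall u : N, f *: u = 0 -> u = 0.
Proof.
move=> fgN ex f_neq0 u fu; have [k [e e_bij]] := kexact_free fgN ex.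
have [e1 [eK e1K]] := linear_inverse e_bij.
case: k e e_bij e1 eK e1K => [|k] e e_bij e1 eK e1K.
  by rewrite -[u]e1K [e1 u]thinmx0 linear0.
have [|ki kiE] := @linear_pack S S^o N (fun a => e (a *: delta_mx 0 0)).
  by move=> a x y; rewrite -linearP scalerDl scalerA.
have [|ho hoE] := @linear_pack S N S^o (fun v => e1 v 0 0).
  by move=> a x y; rewrite linearP !mxE.
have dom : forall a b : S, a * b = 0 -> a = 0 \/ b = 0.
  apply/kexact_domain/(kexact_retract (k := ki) (h := ho)) => //.
  by move=> a; rewrite hoE kiE eK !mxE mulr1.
rewrite -[u]e1K; suff -> : e1 u = 0 by rewrite linear0.
apply/rowP => i; rewrite mxE; have := congr1 (fun v => e1 v 0 i) fu.
rewrite linearZ linear0 !mxE => /dom[f0|//].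
by rewrite f0 eqxx in f_neq0.
Qed.

End RegularParameters.

(** * Depth and Koszul homology *)

Section WeaklyRegular.
Variable R : comNzRingType.

(** Phrased through successive quotient modules, so that an induction on the
    sequence can use [kexact_coker] at each step. *)
Fixpoint weakly_regular (xs : seq R) (N : lmodType R) : Prop :=
  if xs is x :: xs' then
    (forall u : N, x *: u = 0 -> u = 0) /\ weakly_regular xs' (quot_scaled N x)
  else True.

Lemma in_seq_mul_cons (N : lmodType R) x (xs : seq R) (u : N) :
  in_seq_mul (x :: xs) u <-> in_seq_mul xs (quot_proj x u).
Proof.
split.
  case=> v ->; exists (fun i => quot_proj x (v (lift ord0 i))).
  rewrite big_ord_recl linearD /= linear_sum /=.
  have -> : quot_proj x (x *: v ord0) = 0.
    by rewrite -[RHS](linear0 (quot_proj x)); apply/quot_proj_eqP;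
      exists (v ord0); rewrite subr0.
  by rewrite add0r; apply: eq_bigr => i _; rewrite linearZ.
case=> v uv.
have /quot_proj_eqP[w uw] :
    quot_proj x u = quot_proj x (\sum_(i < size xs) xs`_i *: quot_repr (v i)).
  by rewrite uv linear_sum; apply: eq_bigr => i _;
    rewrite linearZ /= quot_reprK.
exists (fun i => if unlift ord0 i is Some j then quot_repr (v j) else w).
rewrite big_ord_recl unlift_none /=.
rewrite -[LHS](subrK (\sum_(i < size xs) xs`_i *: quot_repr (v i))) uw.
by congr (_ + _); apply: eq_bigr => i _; rewrite liftK.
Qed.

Lemma regular_seq_weakly (N : lmodType R) (xs : seq R) :
  regular_seq N xs -> weakly_regular xs N.
Proof.
case=> reg _; elim: xs N reg => //= x xs IH N reg; split=> [u xu|].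
  have [|v ->] := reg 0%N u isT; last by rewrite big_ord0.
  by exists (fun=> 0); rewrite big_ord0.
apply: IH => i u lt_i; rewrite -(quot_reprK u) -linearZ => /in_seq_mul_cons h.
by apply/in_seq_mul_cons; apply: (reg i.+1).
Qed.
End WeaklyRegular.

(** An alias of [N], on which [phi] induces an S-module structure that does not
    interfere with the R-module structure of [N]. *)
Definition restriction (S R : comNzRingType) (phi : {rmorphism S -> R})
  (N : lmodType R) : Type := N.

Section Restriction.
Variables (S R : comNzRingType) (phi : {rmorphism S -> R}).

Section Structure.
Variable N : lmodType R.
Local Notation N' := (restriction phi N).

HB.instance Definition _ := GRing.Zmodule.on N'.

Definition restriction_scale (a : S) (u : N') : N' := phi a *: (u : N).

Fact restriction_scaleA a b u :
  restriction_scale a (restriction_scale b u) = restriction_scale (a * b) u.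
Proof. by rewrite /restriction_scale rmorphM scalerA. Qed.

Fact restriction_scale1 : left_id 1 restriction_scale.
Proof. by move=> u; rewrite /restriction_scale rmorph1 scale1r. Qed.

Fact restriction_scaleDr : right_distributive restriction_scale +%R.
Proof. by move=> a u v; rewrite /restriction_scale scalerDr. Qed.

Fact restriction_scaleDl u : {morph restriction_scale^~ u : a b / a + b}.
Proof. by move=> a b; rewrite /restriction_scale rmorphD scalerDl. Qed.

HB.instance Definition _ :=
  GRing.Zmodule_isLmodule.Build S N' restriction_scaleA restriction_scale1
    restriction_scaleDr restriction_scaleDl.

Lemma restrictionE (a : S) (u : N') : a *: u = phi a *: (u : N) :> N.
Proof. by []. Qed.

Definition homothety (r : R) (u : N') : N' := r *: (u : N).

Fact homothety_linear r : linear (homothety r).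
Proof.
move=> a u v; rewrite /homothety scalerDr; congr (_ + _).
by rewrite !restrictionE !scalerA mulrC.
Qed.

HB.instance Definition _ r :=
  GRing.isLinear.Build S N' N' _ (homothety r) (homothety_linear r).
End Structure.

(** Depth sensitivity of Koszul homology.  The homology vanishes above degree
    [size gs], and each term x of the regular sequence lowers this bound by one
    through [kexact_coker]: a power of x is a combination of elements of gs with
    coefficients in R, and those coefficients map cycles to cycles, so this
    power sends every cycle to a boundary. *)
Lemma kexact_depth (gs : seq S) (xs : seq R) (N : lmodType R) i :
  (forall x, x \in xs ->
     exists n, ideal_mul (map phi gs) (fun _ : R^o => True) (x ^+ n)) ->
  weakly_regular xs N -> (size gs < i + size xs)%N ->
  kexact (restriction phi N) gs i.
Proof.
elim: xs N i => [|x xs IH] N i /= nil.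
  rewrite addn0 => _ lt_gs w wi _; exists 0;
    first exact: (kdeg_submodule _ _ _).1.
  by rewrite linear0 (kdeg_gt lt_gs wi).
case=> x_reg xs_reg; rewrite addnS -addSn => lt_gs.
have nil_xs y (h : y \in xs) := nil y (mem_behead (s := x :: xs) h).
have {IH nil_xs} IH := IH _ _ nil_xs xs_reg lt_gs.
have [n xn] := nil x (mem_head _ _).
have [|p pE] := @linear_pack S (restriction phi N)
    (restriction phi (quot_scaled N x)) (quot_proj x).
  by move=> a u v; apply: linearP.
have p0 : quot_proj x 0 = 0 :> quot_scaled N x by apply: linear0.
apply: (@kexact_coker _ _ _ (homothety x) p gs i n) IH.
- move=> u v uv; apply/eqP; rewrite -subr_eq0; apply/eqP/x_reg.
  by rewrite scalerBr; apply/eqP; rewrite subr_eq0; apply/eqP.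
- by move=> v; exists (quot_repr v); rewrite pE; apply: quot_reprK.
- move=> u; rewrite pE -p0; split.
    by case/quot_proj_eqP => v; rewrite subr0 => ->; exists v.
  by case=> v <-; apply/quot_proj_eqP; exists v; rewrite subr0.
move=> w wi dw.
have -> : iter n (kmap (homothety (N := N) x)) w =
    kmap (homothety (N := N) (x ^+ n)) w.
  elim: n {xn} => [|n IHn] /=; first by rewrite kmap_id // => u;
    exact: (scale1r (u : N)).
  pose xn1 : {linear _ -> _} := homothety (N := N) (x ^+ n.+1).
  rewrite IHn -(@kmap_comp _ _ _ _ _ _ xn1) // => u.
  by rewrite /xn1 /= /homothety exprS; exact: esym (scalerA x (x ^+ n) (u : N)).
suff null cs r : {subset cs <= gs} ->
    ideal_mul (map phi cs) (fun _ : R^o => True) r ->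
    exists2 z, kdeg i.+1 z & kdiff z = kmap (homothety (N := N) r) w.
  exact: (null gs).
have [B0 BP] := kboundary_submodule (restriction phi N) gs i.+1.
elim: cs r => [|g cs IHcs] r sub /=.
  move=> ->; have -> // : kmap (homothety (N := N) 0) w = 0.
  rewrite (@kmap_comb _ _ _ _ idfun idfun 0 0) => [|u].
    by rewrite !scale0r addr0.
  by rewrite !scale0r addr0; exact: (scale0r (u : N)).
case=> a _ /IHcs Br.
have Ba : exists2 z, kdeg i.+1 z & kdiff z = g *: kmap (homothety (N := N) a) w.
  apply: kexact_ideal; first by apply: lin_span_mem; apply: sub;
    exact: mem_head.
    exact: kdeg_kmap.
  by rewrite kdiff_kmap dw linear0.
have -> : kmap (homothety (N := N) r) w =
    1 *: (g *: kmap (homothety (N := N) a) w)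
    + kmap (homothety (N := N) (r - phi g *: a)) w.
  rewrite scale1r -[X in _ + X]scale1r.
  apply: kmap_comb => u; rewrite scale1r restrictionE /homothety.
  suff : r *: (u : N) =
    phi g *: (a *: (u : N)) + (r - phi g * a) *: (u : N) by [].
  by rewrite scalerA -scalerDl addrCA subrr addr0.
apply: BP => //; apply: Br => h hcs; apply: sub.
by rewrite inE hcs orbT.
Qed.
End Restriction.

(** * Maximal ideals and going up *)

Section MaximalAvoiding.
Variables (R : comNzRingType).

Lemma maximal_avoiding (I T : R^o -> Prop) :
  submodule I -> (forall t, T t -> ~ I t) ->
  exists J : R^o -> Prop, [/\ submodule J, forall u, I u -> J u,
    forall t, T t -> ~ J t
    & forall K : R^o -> Prop, submodule K -> (forall u, J u -> K u) ->
      (forall t, T t -> ~ K t) -> forall u, K u -> J u].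
Proof.
move=> IP IT.
pose good (J : R^o -> Prop) :=
  [/\ submodule J, forall u, I u -> J u & forall t, T t -> ~ J t].
have goodI : good I by split.
pose le (J K : {J | good J}) := `[< forall u, sval J u -> sval K u >].
have [J Jmax] : exists J, premaximal le J.
  apply: (@ZL_preorder _ (exist _ I goodI))
    => [J|K J L /asboolP KJ /asboolP JL|A Atot].
  - exact/asboolP.
  - by apply/asboolP => u /KJ/JL.
  pose U u := I u \/ exists2 J, A J & sval J u.
  have goodU : good U.
    split=> [|u Iu|t Tt]; last 2 first.
    - by left.
    - by case=> [/(IT t Tt)//|[[J [_ _ JT]] _ /= /(JT t Tt)]].
    split=> [|a u v Uu Uv]; first by left; exact: IP.1.
    have [AJ|noA] := pselect (exists J, A J); last first.
      have U_I w : U w -> I w by case=> // -[J AJ]; case: noA; exists J.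
      by left; apply: IP.2; apply: U_I.
    have U_A w : U w -> exists2 K, A K & sval K w.
      case: AJ => J AJ [Iw|//]; exists J => //.
      by case: J {AJ} => J [_ IJ _] /=; apply: IJ.
    have [[K AK Ku] [L AL Lv]] := (U_A u Uu, U_A v Uv).
    have [/asboolP KL|/asboolP LK] := Atot K L AK AL.
      by right; exists L => //; case: L KL {AL} Lv => L [LP _ _] /= KL Lv;
        apply: LP.2 => //; apply: KL.
    by right; exists K => //; case: K LK {AK} Ku => K [KP _ _] /= LK Ku;
      apply: KP.2 => //; apply: LK.
  exists (exist _ U goodU) => J AJ; apply/asboolP => u Ju.
  by right; exists J.
case: J Jmax => J goodJ Jmax; exists J;
  case: (goodJ) => JP IJ JT; split=> // K KP JK KT.
have goodK : good K by split=> // u /IJ/JK.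
by have /asboolP := Jmax (exist _ K goodK) (introT (asboolP _) JK).
Qed.

(** A nonunit a generates an ideal that avoids 1; an ideal maximal with this
    property is a maximal ideal, hence equal to [m]. *)
Lemma unique_maximal_idealP (m : {pred R}) : unique_maximal_ideal m ->
  local_ring R /\ forall a, a \in m <-> ~ invertible a.
Proof.
case=> [[[m0 m1 mP] m_max] m_uniq].
have mE a : a \in m <-> ~ invertible a.
  split=> [am [b ab]|an].
    by case/negP: m1; rewrite -ab mulrC -[b * a]addr0; apply: mP.
  pose I (u : R^o) := exists b, u = a * b.
  have [|t ->|J [[J0 JP] IJ JT Jmax]] := @maximal_avoiding I (fun t => t = 1).
  - split=> [|c _ _ [u ->] [v ->]]; first by exists 0; rewrite mulr0.
    by exists (c * u + v); rewrite mulrDr [in RHS]mulrCA.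
  - by case=> b ab; apply: an; exists b.
  pose m' : {pred R} := fun u => `[< J u >].
  have m'_max : maximal_ideal m'.
    split.
      split; [exact/asboolP|apply/negP => /asboolP; exact: JT|].
      by move=> b u v /asboolP Ju /asboolP Jv; apply/asboolP; exact: JP.
    move=> K [K0 K1 KP] m'K u; apply/idP/idP => [Ku|]; last exact: m'K.
    apply/asboolP; apply: (Jmax (fun u => (u : R) \in K)) => //.
    - by move=> v Jv; apply: m'K; apply/asboolP.
    - by move=> t -> K1'; rewrite K1' in K1.
  have am' : a \in m' by apply/asboolP/IJ; exists 1; rewrite mulr1.
  by rewrite (m_uniq m' m'_max) in am'.
split=> // a b iab; apply: contrapT => /not_orP[/mE am /mE bm].
suff /mE : a + b \in m by [].
by rewrite -[a]mul1r; apply: mP.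
Qed.
End MaximalAvoiding.

Section GoingUp.
Variables (S R : comNzRingType) (phi : {rmorphism S -> R}).
Hypothesis phi_inj : injective phi.
Hypothesis phi_int : forall r, integralOver phi r.

(** The prime ideal is an ideal J above I maximal among those that avoid the
    image of the complement of P, a multiplicative set.  If c is in P but
    phi c is not in J, then maximality yields s outside P with phi s = r phi c
    modulo J for some r.  Multiplying a monic equation of degree n of r by
    c^n gives a relation for r phi c, in which s may be substituted modulo J:
    thus s^n plus terms divisible by c lies in P, and s lies in P. *)
Lemma going_up (P : {pred S}) (I : R^o -> Prop) :
  prime_ideal P -> submodule I -> (forall c, I (phi c) -> c \in P) ->
  exists Q : {pred R}, [/\ prime_ideal Q, forall u, I u -> u \in Q
    & forall c, (phi c \in Q) = (c \in P)].
Proof.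
case=> [[P0 P1 PP] P_prime] IP IP_P.
pose T (t : R^o) := exists2 c, c \notin P & t = phi c.
have [|t [c cP ->] /IP_P cP'|J [JP IJ JT Jmax]] := @maximal_avoiding _ I T.
- exact: IP.
- by rewrite cP' in cP.
have JMl a u : J u -> J (a * u) by exact: (submoduleZ a JP).
have JP_P c : J (phi c) -> c \in P.
  by move=> Jc; apply: contrapT => /negP cP; apply: (JT (phi c)) Jc; exists c.
have meets u : ~ J u -> exists r s, s \notin P /\ J (phi s - r * u).
  move=> nJu; pose K (v : R^o) := exists r, J (v - r * u).
  have KP : submodule K.
    split=> [|a v w [r vr] [r' wr']]; first by exists 0;
      rewrite mul0r subr0; exact: JP.1.
    exists (a * r + r'); rewrite mulrDl -mulrA opprD addrACA -mulrBr.
    exact: JP.2.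
  apply: contrapT => no; apply: nJu; apply: (Jmax K KP).
  - by move=> v Jv; exists 0; rewrite mul0r subr0.
  - by move=> _ [s sP ->] [r sr]; apply: no; exists r, s.
  - by exists 1; rewrite mul1r subrr; exact: JP.1.
have PMl a c : c \in P -> a * c \in P by move=> cP; rewrite -[_ * _]addr0;
  exact: PP.
have J_P c : c \in P -> J (phi c).
  move=> cP; apply: contrapT => /meets[r [s [/negP sP Jsr]]].
  have [p p_monic /eqP p_root] := phi_int r.
  have [n size_p] : exists n, size p = n.+1.
    case: (size p) (monic_neq0 p_monic) (size_poly_eq0 p) => [/negPf ->|n] //.
    by exists n.
  pose E := \sum_(i < n.+1) p`_i * c ^+ (n - i) * s ^+ i.
  have JE : J (phi E).
    have zero :
        \sum_(i < n.+1) phi (p`_i * c ^+ (n - i)) * (r * phi c) ^+ i = 0.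
      transitivity (phi c ^+ n * (map_poly phi p).[r]);
        last by rewrite p_root mulr0.
      rewrite (@horner_coef_wide _ n.+1); last by rewrite -size_p size_poly.
      rewrite mulr_sumr; apply: eq_bigr => i _.
      rewrite coef_map exprMn rmorphM rmorphXn /=.
      have -> : phi c ^+ n = phi c ^+ (n - i) * phi c ^+ i.
        by rewrite -exprD subnK // -ltnS.
      by rewrite [phi p`_i * _]mulrC [r ^+ i * _]mulrC mulrACA.
    rewrite -[phi E]subr0 -{}zero rmorph_sum -sumrB.
    apply: (big_ind J); [exact: JP.1|by move=> *; exact: submoduleD|] => i _.
    rewrite rmorphM rmorphXn -mulrBr; apply: (JMl).
    by rewrite subrXX mulrC; apply: (JMl).
  have sn : s ^+ n \in P.
    have := JP_P _ JE; rewrite /E big_ord_recr /= subnn expr0 mulr1.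
    have -> : p`_n = 1 by have /eqP := p_monic; rewrite lead_coefE size_p.
    rewrite mul1r => EP.
    have low : \sum_(i < n) p`_i * c ^+ (n - i) * s ^+ i \in P.
      elim/big_ind: _ => // [u v uP vP|i _]; first by rewrite -[u]mul1r;
        exact: PP.
      rewrite mulrC mulrA; rewrite -(subnSK (ltn_ord i)) exprSr mulrA.
      exact: PMl.
    have := PP (-1) _ _ low EP; by rewrite mulN1r addKr.
  apply: sP; elim: n {size_p E JE} sn => [|n IH];
    first by rewrite expr0 (negPf P1).
  by rewrite exprS => /P_prime/orP[].
exists (fun u => `[< J u >]); split.
- split.
    split; [exact/asboolP/JP.1| |].
      by apply/negP => /asboolP; rewrite -(rmorph1 phi) => /JP_P; apply/negP.
    by move=> a u v /asboolP Ju /asboolP Jv; apply/asboolP; exact: JP.2.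
  move=> u v /asboolP Juv; apply/orP; apply: contrapT => /not_orP[nu nv].
  have [r [s [sP Js]]] := meets u (fun h => nu (introT (asboolP _) h)).
  have [r' [s' [s'P Js']]] := meets v (fun h => nv (introT (asboolP _) h)).
  have /JP_P/P_prime : J (phi (s * s')).
    have -> : phi (s * s') =
        phi s' * (phi s - r * u) +
          (r * u * (phi s' - r' * v) + r * r' * (u * v)).
      by rewrite rmorphM; ring.
    by apply: (submoduleD JP); [exact: JMl|apply: (submoduleD JP); exact: JMl].
  by rewrite (negPf sP) (negPf s'P).
- by move=> u /IJ Ju; apply/asboolP.
- by move=> c; apply/asboolP/idP => [/JP_P|/J_P].
Qed.

(** An integral extension has at least the dimension of its base. *)
Lemma prime_chain_lift d : has_prime_chain S d -> has_prime_chain R d.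
Proof.
case=> P [P_prime P_lt].
suff lift_chain k : (k <= d)%N -> exists Q : nat -> {pred R},
    (forall i, (i <= k)%N ->
       prime_ideal (Q i) /\ forall c, (phi c \in Q i) = (c \in P i))
    /\ forall i, (i < k)%N -> {subset Q i <= Q i.+1}.
  have [Q [Q_prime Q_le]] := lift_chain d (leqnn d); exists Q; split=> i lt_i.
    by have [] := Q_prime i lt_i.
  split; first exact: Q_le.
  have [_ Qi] := Q_prime i (ltnW lt_i); have [_ Qi1] := Q_prime i.+1 lt_i.
  have [_ nP] := P_lt i lt_i; move=> Q_ge; apply: nP => c.
  by rewrite -Qi1 -Qi; apply: Q_ge.
elim: k => [|k IH] lt_k.
  have [|||Q [Q_prime _ QP]] := @going_up (P 0%N) (fun u => u = 0).
  - exact: P_prime.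
  - by split=> // a u v -> ->; rewrite scaler0 addr0.
  - move=> c; rewrite -(rmorph0 phi) => /phi_inj ->.
    by have [[]] := P_prime 0%N isT.
  by exists (fun=> Q); split=> // i; rewrite leqn0 => /eqP ->.
have [Q [Q_prime Q_le]] := IH (ltnW lt_k).
have [[[Qk0 _ QkP] _] QkE] := Q_prime k (leqnn k).
have [|||Q' [Q'_prime QQ' Q'P]] := @going_up (P k.+1) (fun u => u \in Q k).
- exact: P_prime.
- by split=> // a u v; apply: QkP.
- by move=> c; rewrite QkE; apply: (P_lt k lt_k).1.
exists (fun i => if (i <= k)%N then Q i else Q'); split=> i.
  rewrite leq_eqVlt => /orP[/eqP ->|]; first by rewrite ltnn.
  by rewrite ltnS => le_i; rewrite le_i; apply: Q_prime.
rewrite ltnS => le_i; rewrite le_i; case: ltnP => [lt_i|ge_i];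
  first exact: Q_le.
by have -> : i = k; [apply/eqP; rewrite eqn_leq le_i|exact: QQ'].
Qed.

End GoingUp.

(** * The branched cover S[y]/(f + y^n) *)

Lemma fin_gen_regular (A : comNzRingType) : fin_gen A^o.
Proof.
exists 1%N, (fun=> 1) => x; exists (fun=> x).
by rewrite big_ord1 /GRing.scale /= mulr1.
Qed.

Section BranchedCover.
Variables (S : comNzRingType) (f : S) (n : nat).
Hypothesis n_gt0 : (0 < n)%N.

Local Notation h := (cover_poly f n).
Local Notation R := {poly %/ h}.

Definition cover_const : {rmorphism S -> R} := in_qpoly h \o polyC.
Local Notation phi := cover_const.
Local Notation y := ('qX : R).

Lemma cover_constE c : phi c = in_qpoly h c%:P. Proof. by []. Qed.

Lemma in_qpoly_val (a : R) : in_qpoly h (val a) = a.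
Proof. exact/val_inj/in_qpoly_small/size_mk_monic. Qed.

Lemma cover_poly_monic : h \is monic.
Proof. by rewrite -(mk_monic_cover_poly f n_gt0); exact: monic_mk_monic. Qed.

Lemma size_cover_poly : size h = n.+1.
Proof.
rewrite /cover_poly addrC size_polyDl size_polyXn // ltnS.
exact: leq_trans (size_polyC_leq1 f) n_gt0.
Qed.

Lemma in_qpoly_eq0 (p : {poly S}) : in_qpoly h p = 0 <-> exists q, p = q * h.
Proof.
split=> [/(congr1 val) /=|[q ->]].
  rewrite mk_monic_cover_poly // => p0; exists (Pdiv.CommonRing.rdivp p h).
  by rewrite [LHS](Pdiv.RingMonic.rdivp_eq cover_poly_monic) p0 addr0.
apply: val_inj; rewrite /= mk_monic_cover_poly //.
exact: Pdiv.RingMonic.rmodp_mull cover_poly_monic _.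
Qed.

Lemma cover_root : y ^+ n = - phi f.
Proof.
apply/eqP; rewrite -subr_eq0 opprK -rmorphXn -rmorphD /=;
  apply/eqP/in_qpoly_eq0.
by exists 1; rewrite mul1r addrC.
Qed.

Lemma cover_const_inj : injective phi.
Proof.
move=> a b /(congr1 val); rewrite /= -/(val (in_qpoly h a%:P)).
have size_const c : (size c%:P < size (mk_monic h))%N.
  exact: leq_ltn_trans (size_polyC_leq1 c) (size_mk_monic_gt1 h).
by rewrite !Pdiv.CommonRing.rmodp_small // => /polyC_inj.
Qed.

Lemma cover_sum (a : R) : exists c : 'I_n -> S, a = \sum_i phi (c i) * y ^+ i.
Proof.
pose p : {poly S} := val a.
exists (fun i => p`_i); rewrite -[LHS]in_qpoly_val.
have -> : val a = \sum_(i < n) (p`_i)%:P * 'X^i.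
  under eq_bigr do rewrite mul_polyC; rewrite -poly_def.
  apply/polyP => i; rewrite coef_poly; case: ltnP => // le_ni.
  rewrite nth_default // (leq_trans _ le_ni) // -ltnS -size_cover_poly.
  have <- : size (mk_monic h) = size h by rewrite mk_monic_cover_poly.
  exact: size_mk_monic.
by rewrite rmorph_sum; apply: eq_bigr => i _; rewrite rmorphM rmorphXn.
Qed.

Lemma cover_split (a : R) : exists c q, a = phi c + y * q.
Proof.
rewrite -(in_qpoly_val a); elim/poly_ind: (val a) => [|p c _].
  by exists 0, 0; rewrite !rmorph0 mulr0 addr0.
by exists c, (in_qpoly h p); rewrite rmorphD rmorphM /= addrC mulrC.
Qed.

(** Comparison of constant terms: R/(y) is S/(f). *)
Lemma cover_const_mulX c (z : R) : phi c = y * z -> exists t, c = f * t.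
Proof.
move=> cyz; have : in_qpoly h (c%:P - 'X * val z) = 0.
  by rewrite rmorphB rmorphM /= in_qpoly_val -cover_constE cyz subrr.
case/in_qpoly_eq0 => q /(congr1 (fun p => p.[0])).
rewrite !hornerE subr0 expr0n eqn0Ngt n_gt0 /= addr0 => ->.
by exists q.[0]; rewrite mulrC.
Qed.

Lemma cover_integral (a : R) : integralOver phi a.
Proof.
have y_int : integralOver phi y.
  exists h; first exact: cover_poly_monic.
  rewrite /root rmorphD /= map_polyC map_polyXn !hornerE cover_root.
  by rewrite addrN.
rewrite -(in_qpoly_val a); elim/poly_ind: (val a) => [|p c IH].
  rewrite rmorph0; exact: integral0.
rewrite rmorphD rmorphM; apply: integral_add; last exact: integral_id.
exact: integral_mul.
Qed.

Lemma fin_gen_restriction (N : lmodType R) :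
  fin_gen N -> fin_gen (restriction phi N).
Proof.
case=> r [g gen].
pose w (p : 'I_n * 'I_r) : restriction phi N := y ^+ p.1 *: g p.2.
exists #|{: 'I_n * 'I_r}|, (w \o enum_val) => u.
have [a ->] := gen u; have [c aE] := choice (fun j => cover_sum (a j)).
exists (fun k => c (enum_val k).2 (enum_val k).1).
transitivity (\sum_p c p.2 p.1 *: w p); last first.
  by rewrite (reindex _ (onW_bij _ (@enum_val_bij _))).
rewrite -(pair_bigA _ (fun i j => c j i *: w (i, j))) exchange_big /=.
apply: eq_bigr => j _; rewrite {1}aE scaler_suml; apply: eq_bigr => i _.
by rewrite restrictionE scalerA.
Qed.

Section Local.
Hypotheses (S_local : local_ring S) (f_noninv : ~ invertible f).

(** From right to left, a = c + y q divides c^n - (- y q)^n, which differs from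
    the unit c^n by a multiple of f.  Hence R = a R + f R, and Nakayama over S
    applies to the finite S-module R.  From left to right, the constant terms
    of an inverse show that 1 - c c' is a multiple of the nonunit f. *)
Lemma cover_invertible c (q : R) : invertible (phi c + y * q) <-> invertible c.
Proof.
split.
  case=> b ab; have [c' [q' bE]] := cover_split b.
  have [|t tE]
    := @cover_const_mulX (1 - c * c') (phi c * q' + q * phi c' + q * y * q').
    rewrite rmorphB rmorph1 rmorphM -ab bE; ring.
  have [|ft|] := S_local (a := 1 - c * c') (b := c * c').
  - by rewrite subrK; exact: invertible1.
  - by rewrite tE in ft; case: f_noninv; exact: invertibleMl ft.
  - exact: invertibleMl.
case=> c' cc'; set a := phi c + y * q.
pose L (u : restriction phi R^o) := exists t : R, u = a * t :> R.
suff [b ab] : L 1 by exists b.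
have LP : submodule L.
  split=> [|d _ _ [t ->] [t' ->]]; first by exists 0; rewrite mulr0.
  by exists (phi d * t + t'); rewrite mulrDr [in RHS]mulrCA.
have [vs gen] := fin_gen_span (fin_gen_restriction (fin_gen_regular R)).
apply: (nakayama (M := fun=> True) (vs := vs) S_local LP) => // [u _|u _].
  by exists 0; [exact: LP.1|exact: gen].
have := subrXX (phi c) (- (y * q)) n; rewrite opprK -/a.
set s := \sum_(_ < _) _ => as_.
pose v : R := u; pose d := phi (c' ^+ n) * v.
have vE : v = a * (s * d) + phi f * (- (- q) ^+ n * d).
  rewrite mulrA -as_ -mulrN exprMn cover_root mulrBl !mulNr opprK mulrN mulrA.
  by rewrite addrK mulrA -rmorphXn -rmorphM -exprMn cc' expr1n rmorph1 mul1r.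
exists [:: f], (a * (s * d)); split=> [g|| /=].
- by rewrite inE => /eqP ->.
- by exists (s * d).
exists (- (- q) ^+ n * d) => //; apply/eqP.
by rewrite -addrA -opprD subr_eq0 -[u]/v {1}vE.
Qed.

Lemma cover_local : local_ring R.
Proof.
move=> a b; have [c [q ->]] := cover_split a.
have [c' [q' ->]] := cover_split b.
rewrite addrACA -rmorphD -mulrDr => /cover_invertible/S_local[] inv.
  by left; apply/cover_invertible.
by right; apply/cover_invertible.
Qed.

(** With x = c + y q for a nonunit c, the power x^n is (y q)^n = - f q^n modulo
    c, and both c and f lie in the maximal ideal of S. *)
Lemma cover_nonunit_pow (gs : seq S) (x : R) :
  (forall c, ~ invertible c -> @lin_span S S^o gs c) -> ~ invertible x ->
  ideal_mul (map phi gs) (fun _ : R^o => True) (x ^+ n).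
Proof.
move=> gs_gen.
have ext c (s : R) : ~ invertible c ->
    ideal_mul (map phi gs) (fun _ : R^o => True) (phi c * s).
  move/gs_gen; elim: (gs) c => [|g cs IH] c /=; first by move->;
    rewrite rmorph0 mul0r.
  case=> d /IH; rewrite rmorphB mulrBl => cd; exists (phi d * s) => //.
  have <- // : phi (d *: (g : S^o)) * s = phi g *: (phi d * s : R^o).
  by rewrite [phi _](rmorphM phi d g) -mulrA mulrCA.
have [c [q ->]] := cover_split x => xn.
have cn : ~ invertible c by move=> ci; apply: xn; apply/cover_invertible.
have JP : submodule (ideal_mul (map phi gs) (fun _ : R^o => True)).
  exact: ideal_mul_submodule.
rewrite -[_ ^+ n](subrK ((y * q) ^+ n)) subrXX addrK exprMn cover_root.
rewrite mulNr -mulrN.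
exact: (submoduleD JP (ext _ _ cn) (ext _ _ f_noninv)).
Qed.

End Local.
End BranchedCover.

(** * Minimal free covers over a local ring *)

Section FreeCovers.
Variable R : comNzRingType.

Lemma free_lift (V X : lmodType R) s (e : {linear V -> X})
    (h : {linear 'rV[R]_s -> X}) :
  surjective_map e ->
  exists a : {linear 'rV[R]_s -> V}, forall u, e (a u) = h u.
Proof.
move=> e_surj; have [w wE] := choice (fun i => e_surj (h (delta_mx 0 i))).
exists (free_map w) => u; rewrite [in RHS](row_sum_delta u) !linear_sum.
by apply: eq_bigr => i _; rewrite !linearZ /= wE.
Qed.

Lemma surj_endo_inj r (a : {linear 'rV[R]_r -> 'rV[R]_r}) :
  surjective_map a -> injective a.
Proof.
move=> a_surj; have [b bE] := choice (fun i => a_surj (delta_mx 0 i)).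
pose A := lin1_mx a; pose B := \matrix_i b i.
have BA : B *m A = 1%:M.
  by apply/row_matrixP => i; rewrite row_mul rowK mul_rV_lin1 /= bE row1.
move=> u v uv; rewrite -[u]mulmx1 -[v]mulmx1 -(mulmx1C BA) !mulmxA.
by rewrite !mul_rV_lin1 /= uv.
Qed.

Hypothesis R_local : local_ring R.

(** An endomorphism of the covering module compatible with the cover is the
    identity modulo the kernel, whose vectors have nonunit entries; Nakayama
    applies to its image. *)
Lemma minimal_cover_endo (X : lmodType R) r (e : {linear 'rV[R]_r -> X})
    (g : {linear 'rV[R]_r -> 'rV[R]_r}) :
  minimal_free_cover e -> (forall u, e (g u) = e u) -> surjective_map g.
Proof.
move=> e_min eg u.
pose L (u : 'rV[R]_r) := exists v, g v = u.
have LP : submodule L.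
  split=> [|a _ _ [v <-] [w <-]]; first by exists 0; rewrite linear0.
  by exists (a *: v + w); rewrite linearP.
have span v : lin_span [seq delta_mx 0 i | i <- enum 'I_r] (v : 'rV[R]_r).
  by rewrite [v]row_sum_delta -big_enum; exact: lin_span_sum.
apply: (nakayama (M := fun=> True) R_local LP _ _ _ _ I) => // [v _|v _].
  by exists 0; [exact: LP.1|rewrite subr0; exact: span].
pose w := v - g v.
exists [seq w 0 i | i <- enum 'I_r], (g v); split=> [c /mapP[i _ ->]||].
- by apply: minimal_cover_ker e_min _; rewrite linearB /= eg subrr.
- by exists v.
by rewrite -/w [X in ideal_mul _ _ X]row_sum_delta -big_enum;
  exact: ideal_mul_sum.
Qed.

(** Lifting each cover through the other gives maps a and b; a b and b a are
    surjective endomorphisms of free modules of finite rank, hence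
    injective. *)
Lemma minimal_cover_unique (X : lmodType R) r s (e : {linear 'rV[R]_r -> X})
    (e' : {linear 'rV[R]_s -> X}) :
  minimal_free_cover e -> minimal_free_cover e' ->
  exists2 a : {linear 'rV[R]_s -> 'rV[R]_r}, bijective a
    & forall u, e (a u) = e' u.
Proof.
move=> e_min e'_min.
have [a aE] := free_lift e' e_min.1; have [b bE] := free_lift e e'_min.1.
exists a => //.
have ab_surj : surjective_map (a \o b).
  by apply: (minimal_cover_endo e_min) => u; rewrite /= aE bE.
have ba_surj : surjective_map (b \o a).
  by apply: (minimal_cover_endo e'_min) => u; rewrite /= bE aE.
have a_inj : injective a.
  by move=> u v uv; apply: (surj_endo_inj ba_surj); rewrite /= uv.
have [k kE] := choice ab_surj.
by exists (b \o k) => u; [apply: a_inj|]; exact: kE.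
Qed.

(** A cover of N/xN lifts to a map to N, surjective by Nakayama; so N/xN does
    not need fewer generators than N. *)
Lemma minimal_cover_quotient (N : lmodType R) x s (e : {linear 'rV[R]_s -> N}) :
  ~ invertible x -> minimal_free_cover e ->
  minimal_free_cover (quot_proj x \o e).
Proof.
move=> xn [e_surj e_min]; split.
  by move=> v; have [u uE] := e_surj (quot_repr v); exists u;
    rewrite /= uE quot_reprK.
move=> t h h_surj.
have proj_surj : surjective_map (quot_proj x : N -> _).
  by move=> v; exists (quot_repr v); exact: quot_reprK.
have [c cE] := free_lift h proj_surj; apply: (e_min t c) => u.
pose L (u : N) := exists v, c v = u.
have LP : submodule L.
  split=> [|a _ _ [v <-] [w <-]]; first by exists 0; rewrite linear0.
  by exists (a *: v + w); rewrite linearP.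
have span v : lin_span [seq e (delta_mx 0 i) | i <- enum 'I_s] v.
  have [w <-] := e_surj v; rewrite [w]row_sum_delta linear_sum -big_enum.
  under eq_bigr do rewrite linearZ /=.
  exact: lin_span_sum.
apply: (nakayama (M := fun=> True) R_local LP _ _ _ _ I) => // [v _|v _].
  by exists 0; [exact: LP.1|rewrite subr0; exact: span].
have [w wE] := h_surj (quot_proj x v).
have /quot_proj_eqP[z vz] : quot_proj x v = quot_proj x (c w) by rewrite cE.
exists [:: x], (c w); split=> [a||]; first by rewrite inE => /eqP ->.
  by exists w.
by exists z; rewrite ?vz ?subrr.
Qed.

(** Up to the comparison [a] of minimal covers, the syzygy of N/xN consists of
    the u with e' u in xN.  If e' u = x v, then u - t v lies in the kernel of
    e', and v is determined by u since x is regular; so (v, w) |-> t v + w is an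
    isomorphism. *)
Lemma syzygy_quotient_split (N : lmodType R) (x : R) r s
    (e : {linear 'rV[R]_r -> quot_scaled N x}) (e' : {linear 'rV[R]_s -> N})
    (t : {linear N -> 'rV[R]_s}) :
  ~ invertible x -> (forall v : N, x *: v = 0 -> v = 0) ->
  minimal_free_cover e -> minimal_free_cover e' ->
  (forall v, e' (t v) = x *: v) ->
  mod_iso (ker_mod e) (N * ker_mod e')%type.
Proof.
move=> x_noninv x_reg e_cover e'_cover tE.
have [a a_bij aE] := minimal_cover_unique e_cover
  (minimal_cover_quotient x_noninv e'_cover).
have ker_e (p : N * ker_mod e') : a (t p.1 + val p.2) \in ker_pred e.
  rewrite unfold_in /= aE /=; apply/eqP; rewrite -[RHS](linear0 (quot_proj x)).
  apply/quot_proj_eqP; exists p.1; rewrite subr0 linearD /= tE.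
  by have /eqP -> : e' (val p.2) == 0; [exact: (valP p.2)|rewrite addr0].
pose F0 p : ker_mod e := exist _ (a (t p.1 + val p.2)) (ker_e p).
have F0L : linear (F0 : N * ker_mod e' -> ker_mod e).
  move=> c p q; apply: val_inj => /=.
  by rewrite -[RHS](linearP a) (linearP t) scalerDr addrACA.
have [F FE] := linear_pack F0L.
have F_inj : injective F.
  move=> p q; rewrite !FE => /(congr1 val) /= /(bij_inj a_bij) pq.
  have e'_val (w : ker_mod e') : e' (val w) = 0 by apply/eqP; exact: (valP w).
  have p1 : p.1 = q.1.
    have xpq : x *: p.1 = x *: q.1.
      by have := congr1 e' pq; rewrite !linearD /= !tE !e'_val !addr0.
    apply/eqP; rewrite -subr_eq0; apply/eqP/x_reg.
    by rewrite scalerBr xpq subrr.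
  rewrite [p]surjective_pairing [q]surjective_pairing p1; congr pair.
  by apply: val_inj; move: pq; rewrite p1 => /addrI.
have F_surj w : exists p, F p = w.
  case: a_bij => a1 aK a1K; pose u := a1 (val w).
  have /quot_proj_eqP[v vE] : quot_proj x (e' u) = quot_proj x 0.
    rewrite linear0; have /= <- := aE u.
    by rewrite a1K; apply/eqP; exact: (valP w).
  rewrite subr0 in vE.
  have kerP : u - t v \in ker_pred e'.
    by rewrite unfold_in /= linearB /= tE vE subrr.
  pose w' : ker_mod e' := exist (fun z => z \in ker_pred e') _ kerP.
  exists (v, w'); rewrite FE; apply: val_inj => /=.
  by rewrite addrC subrK a1K.
have [F1 F1K] := choice F_surj.
have F_bij : bijective F by exists F1 => // p; apply: F_inj; rewrite F1K.
have [F' [FK F'K]] := linear_inverse F_bij.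
by exists F'; exists F.
Qed.

End FreeCovers.

(** * Maximal Cohen-Macaulay modules over the branched cover *)

Section MCMFree.
Variables (S : comNzRingType) (f : S) (n : nat).
Hypotheses (n_gt0 : (0 < n)%N) (S_regular : regular_local S).
Hypothesis f_noninv : ~ invertible f.

Local Notation R := {poly %/ cover_poly f n}.
Local Notation phi := (cover_const f n).
Local Notation y := ('qX : R).

Lemma regular_local_ring : local_ring S.
Proof. by case: S_regular => _ [m [d [/unique_maximal_idealP[]]]]. Qed.

(** The list generates the maximal ideal of S and has length dim S.  Unless N
    is zero, its depth is dim R, which is at least dim S by going up, so
    [kexact_depth] reaches degree 1. *)
Lemma MCM_kexact (N : lmodType R) : MCM N -> exists gs : seq S,
  [/\ forall g, g \in gs -> ~ invertible g,
      forall a, ~ invertible a -> @lin_span S S^o gs a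
    & kexact (restriction phi N) gs 1].
Proof.
case: S_regular => S_noeth [m [d [m_max S_dim [g gen]]]].
have [S_local mE] := unique_maximal_idealP m_max.
case=> fgN depthN; exists (codom g).
have gs_gen a : ~ invertible a -> @lin_span S S^o (codom g) a.
  move=> /mE/gen[c ->]; rewrite codomE -big_enum; exact: lin_span_sum.
split=> // [_ /codomP[i ->]|].
  apply/mE/gen; exists (fun j => (j == i)%:R).
  rewrite (bigD1 i) //= eqxx scale1r big1 ?addr0 // => j /negPf ->.
  by rewrite scale0r.
case: depthN => [N0|[m' [d' [/unique_maximal_idealP[_ m'E] R_dim depthN]]]].
  move=> w _ _; suff -> : w = 0.
    by exists 0; [exact: (kdeg_submodule _ _ _).1|rewrite linear0].
  elim: (codom g) w => [|c cs IH] w; first exact: N0.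
  by rewrite [w]surjective_pairing (IH w.1) (IH w.2).
case: depthN => -[xs [xs_m' /regular_seq_weakly xs_reg xs_size]] _.
apply: (kexact_depth (xs := xs)) => // [x /xs_m' /m'E xn|].
  exists n; exact: cover_nonunit_pow.
rewrite size_codom card_ord add1n ltnS xs_size; apply: R_dim.2.
exact: (prime_chain_lift (@cover_const_inj S f n) (cover_integral n_gt0)
  S_dim.1).
Qed.

Lemma MCM_torsion_free (N : lmodType R) (u : N) :
  MCM N -> f != 0 -> phi f *: u = 0 -> u = 0.
Proof.
move=> N_MCM f_neq0 fu; have [gs [small gen ex]] := MCM_kexact N_MCM.
apply: (kexact_torsion_free (N := restriction phi N) regular_local_ring _
  small gen _ ex f_neq0) fu.
  exact/noetherian_regular/S_regular.1.
exact: fin_gen_restriction N_MCM.1.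
Qed.

Lemma MCM_section (N : lmodType R) s (e : {linear 'rV[R]_s -> N}) :
  MCM N -> surjective_map e ->
  exists t : {linear restriction phi N -> restriction phi 'rV[R]_s},
    forall v, e (t v) = v.
Proof.
move=> N_MCM e_surj; have [gs [small gen ex]] := MCM_kexact N_MCM.
have [k [b b_bij]] : exists k (b : {linear 'rV[S]_k -> restriction phi N}),
    bijective b.
  apply: (kexact_free regular_local_ring _ small gen _ ex).
    exact/noetherian_regular/S_regular.1.
  exact: fin_gen_restriction N_MCM.1.
have [b1 [_ b1K]] := linear_inverse b_bij.
have [e_S e_SE] :
    exists e_S : {linear restriction phi 'rV[R]_s -> restriction phi N},
    e_S =1 e.
  by apply: linear_pack => a u v; rewrite !restrictionE linearP.
have [|c cE] := @free_lift S _ _ k e_S b.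
  by move=> v; have [u <-] := e_surj v; exists u.
by exists (c \o b1) => v; rewrite -e_SE /= cE b1K.
Qed.

(** Averaging an S-linear section t over the powers of y.  The sum T below is
    the contraction of t with (X^n - Y^n) / (X - Y), which is what makes it
    commute with y. *)
Lemma mul_pow_factors (N : lmodType R) s (e : {linear 'rV[R]_s -> N}) :
  invertible (n%:R : S) -> MCM N -> surjective_map e ->
  exists t : {linear N -> 'rV[R]_s}, forall v, e (t v) = y ^+ n.-1 *: v.
Proof.
case=> c nc N_MCM e_surj; have [t tE] := MCM_section N_MCM e_surj.
have tD (u v : N) : t (u + v : N) = t u + t v :> 'rV[R]_s by exact: raddfD.
have tZ a (v : N) : t (phi a *: v : N) = phi a *: (t v : 'rV[R]_s).
  exact: (linearZ_LR t a v).
pose T (v : N) : 'rV[R]_s :=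
  \sum_(i < n) y ^+ i *: (t (y ^+ (n.-1 - i) *: v : N) : 'rV[R]_s).
have TD u v : T (u + v) = T u + T v.
  by rewrite -big_split; apply: eq_bigr => i _; rewrite scalerDr tD scalerDr.
have TC a v : T (phi a *: v) = phi a *: T v.
  rewrite scaler_sumr; apply: eq_bigr => i _.
  by rewrite scalerA mulrC -scalerA tZ !scalerA mulrC.
have TX v : T (y *: v) = y *: T v.
  pose F i : 'rV[R]_s := y ^+ i *: (t (y ^+ (n - i) *: v : N) : 'rV[R]_s).
  transitivity (\sum_(i < n) F i).
    apply: eq_bigr => i _; rewrite /F scalerA -exprSr.
    by rewrite -subSn ?prednK // -ltnS prednK.
  transitivity (\sum_(i < n) F i.+1); last first.
    rewrite scaler_sumr; apply: eq_bigr => i _.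
    by rewrite /F scalerA -exprS subnS predn_sub.
  (* The end terms agree because y^n = - phi f commutes with t. *)
  have F0n : F 0%N = F n.
    by rewrite /F subn0 subnn !expr0 !scale1r cover_root // -rmorphN tZ.
  apply: (addIr (F n)); transitivity (\sum_(i < n.+1) F i).
    by rewrite big_ord_recr.
  by rewrite big_ord_recl F0n addrC.
have TZ a v : T (a *: v) = a *: T v.
  rewrite -(in_qpoly_val a); elim/poly_ind: (val a) v => [|p b IH] v.
    by rewrite rmorph0 -(rmorph0 phi) TC.
  by rewrite rmorphD rmorphM !scalerDl TD -!scalerA IH TX TC.
have [|t' t'E] := @linear_pack R N 'rV[R]_s (fun v => phi c *: T v).
  by move=> a u v; rewrite TD TZ scalerDr !scalerA mulrC.
exists t' => v; rewrite t'E linearZ linear_sum /=.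
under eq_bigr => i _ do rewrite linearZ /= tE scalerA -exprD.
have -> : \sum_(i < n) y ^+ (i + (n.-1 - i)) *: v =
    (n%:R : R) *: (y ^+ n.-1 *: v).
  rewrite -[n in n%:R]card_ord scaler_nat -sumr_const; apply: eq_bigr => i _.
  by rewrite subnKC // -ltnS prednK.
have cn : phi c * n%:R = 1.
  by rewrite -(rmorph_nat phi n) -(rmorphM phi) mulrC nc rmorph1.
by rewrite [LHS]scalerA -cover_constE cn scale1r.
Qed.

End MCMFree.

Theorem proposition2p5 (S : comUnitRingType) (f : S) (n : nat)
    (S_regular : regular_local S)
    (f_neq0 : f != 0) (f_nonunit : f \isn't a GRing.unit)
    (n_ge2 : (2 <= n)%N) (n_unit : (n%:R : S) \is a GRing.unit)
    (N : lmodType {poly %/ cover_poly f n}) (N_MCM : MCM N)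
    (r : nat)
    (e : {linear 'rV[{poly %/ cover_poly f n}]_r ->
                 quot_scaled N ('qX ^+ n.-1)})
    (e_cover : minimal_free_cover e)
    (s : nat)
    (e' : {linear 'rV[{poly %/ cover_poly f n}]_s -> N})
    (e'_cover : minimal_free_cover e') :
  mod_iso (ker_mod e) (N * ker_mod e')%type.
Proof.
have n_gt0 : (0 < n)%N by exact: ltnW.
have f_noninv : ~ invertible f.
  by case=> g fg; case/negP: f_nonunit; apply/unitrP; exists g;
    rewrite mulrC fg.
have n_inv : invertible (n%:R : S) by exists n%:R^-1; rewrite divrr.
have S_local := regular_local_ring S_regular.
have R_local := cover_local n_gt0 S_local f_noninv.
pose x : {poly %/ cover_poly f n} := 'qX ^+ n.-1.
have x_noninv : ~ invertible x.
  (* The constant term of x is 0, because n >= 2. *)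
  have -> : x = cover_const f n 0 + 'qX * 'qX ^+ n.-2.
    by rewrite rmorph0 add0r -exprS /x; case: (n) n_ge2 => [|[]].
  by move/(cover_invertible n_gt0 S_local f_noninv)/not_invertible0.
have x_reg (v : N) : x *: v = 0 -> v = 0.
  move=> xv; apply: (MCM_torsion_free n_gt0 S_regular f_noninv N_MCM f_neq0).
  apply/eqP; rewrite -oppr_eq0 -scaleNr -cover_root //.
  by rewrite -[n in _ ^+ n](prednK n_gt0) exprS -scalerA xv scaler0.
have [t tE] := mul_pow_factors n_gt0 S_regular f_noninv n_inv N_MCM e'_cover.1.
exact: (syzygy_quotient_split R_local x_noninv x_reg e_cover e'_cover tE).
Qed.
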